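(* For an integer $d\ge 1$, write $28(d-1)=13d_0+d_1$ with integers $d_0,d_1$, where $0\le d_1<13$. Then $d_0$ is the degree of the Hilbert series of $R_{4,7,d}$ and the leading coefficient is the coefficient of $t^{d_1}$ in \[\frac{\left(1-t^{\,1+13(d-1)-6d_0}\right)^7}{(1-t)^4},\] which for $d\ge 73$ or $d_0\ge 15d_1$ equals $\binom{d_1+3}{3}$.
   Context: Let $\Bbbk$ be a field of characteristic zero. $R_{4,7,d}=\Bbbk[x_1,x_2,x_3,x_4]/(\ell_1^d,\ldots,\ell_7^d)$, where $\ell_1,\ldots,\ell_7$ are general linear forms, i.e. the statement holds for all $(\ell_1,\dots,\ell_7)$ in some nonempty Zariski open subset of the space of $7$-tuples of linear forms. The Hilbert series of a standard graded algebra $A$ is $\sum_i\dim_\Bbbk(A_i)t^i$; here it is a polynomial, and its leading coefficient is the coefficient in its top degree. *)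

(* Defs.v *)
From HB Require Import structures.
From mathcomp Require Import all_boot all_algebra.
From mathcomp Require Import boolp.
From mathcomp Require Import generic_quotient ring_quotient.
From mathcomp Require Import mpoly.

Set Implicit Arguments.
Unset Strict Implicit.
Unset Printing Implicit Defensive.

Import GRing.Theory.
Local Open Scope ring_scope.
Local Open Scope quotient_scope.

Section Ideal.
Variables (K : fieldType) (n r : nat) (g : 'I_r -> {mpoly K[n]}).

Definition in_ideal : pred {mpoly K[n]} :=
  fun p => `[< exists c : 'I_r -> {mpoly K[n]}, p = \sum_j c j * g j >].

Lemma in_idealM (a p : {mpoly K[n]}) : p \in in_ideal -> a * p \in in_ideal.
Proof.
move=> /asboolP[c ->]; apply/asboolP; exists (fun j => a * c j).
by rewrite mulr_sumr; apply: eq_bigr => j _; rewrite mulrA.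
Qed.

Lemma in_ideal_zmod_closed : zmod_closed in_ideal.
Proof.
split=> [|p q /asboolP[a ->] /asboolP[b ->]]; apply/asboolP.
  by exists (fun=> 0); rewrite big1 // => j _; rewrite mul0r.
exists (fun j => a j - b j); rewrite -sumrB.
by apply: eq_bigr => j _; rewrite mulrBl.
Qed.

HB.instance Definition _ :=
  GRing.isZmodClosed.Build {mpoly K[n]} in_ideal in_ideal_zmod_closed.

Definition ideal : zmodClosed {mpoly K[n]} :=
  GRing.ZmodClosed.clone {mpoly K[n]} in_ideal _.

(* The algebra K[x_1, ..., x_n] / (g_1, ..., g_r), as a K-vector space. *)
Definition quot_alg : Type := {ideal_quot ideal}.
HB.instance Definition _ := Choice.on quot_alg.
HB.instance Definition _ := GRing.Zmodule.on quot_alg.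

Definition quot_pi (p : {mpoly K[n]}) : quot_alg := \pi_({ideal_quot ideal}) p.

Lemma quot_piE (p q : {mpoly K[n]}) :
  (quot_pi p == quot_pi q) = (p - q \in in_ideal).
Proof. by rewrite /quot_pi -Quotient.idealrBE. Qed.

Lemma quot_piK (x : quot_alg) : quot_pi (repr (x : {ideal_quot ideal})) = x.
Proof. exact: reprK. Qed.

Lemma quot_piD (p q : {mpoly K[n]}) : quot_pi (p + q) = quot_pi p + quot_pi q.
Proof. exact: Quotient.pi_add. Qed.

Definition quot_scale (a : K) (x : quot_alg) : quot_alg :=
  quot_pi (a *: repr (x : {ideal_quot ideal})).

Lemma quot_piZ a (p : {mpoly K[n]}) :
  quot_pi (a *: p) = quot_scale a (quot_pi p).
Proof.
apply/eqP; rewrite quot_piE -scalerBr -mul_mpolyC; apply: in_idealM.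
by rewrite -quot_piE quot_piK.
Qed.

Fact quot_scaleA a b x : quot_scale a (quot_scale b x) = quot_scale (a * b) x.
Proof. by rewrite -(quot_piK x) -!quot_piZ scalerA. Qed.

Fact quot_scale1 : left_id 1 quot_scale.
Proof. by move=> x; rewrite -(quot_piK x) -quot_piZ scale1r. Qed.

Fact quot_scaleDr : right_distributive quot_scale +%R.
Proof.
move=> a x y; rewrite -(quot_piK x) -(quot_piK y).
by rewrite -quot_piD -!quot_piZ -quot_piD scalerDr.
Qed.

Fact quot_scaleDl x : {morph quot_scale^~ x : a b / a + b}.
Proof. by move=> a b; rewrite -(quot_piK x) -!quot_piZ -quot_piD scalerDl. Qed.

HB.instance Definition _ := GRing.Zmodule_isLmodule.Build K quot_alg
  quot_scaleA quot_scale1 quot_scaleDr quot_scaleDl.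

Definition graded_piece (i : nat) (x : quot_alg) : Prop :=
  exists2 f : {mpoly K[n]}, f \is i.-homog & x = quot_pi f.

End Ideal.

Arguments graded_piece {K n r} g i x.

(* [quot_alg] is infinite-dimensional in general, so the library's [\dim],
   which needs a [vectType], does not apply. *)
Definition has_dim (K : fieldType) (V : lmodType K) (W : V -> Prop) (m : nat)
    : Prop :=
  exists v : 'I_m -> V,
    [/\ forall i, W (v i),
        forall c : 'I_m -> K, \sum_i c i *: v i = 0 -> forall i, c i = 0
      & forall w, W w -> exists c : 'I_m -> K, w = \sum_i c i *: v i].

(* Meaningful as the Hilbert series of a standard graded algebra only when the
   [g j] are homogeneous. *)
Definition is_hilbert_series (K : fieldType) (n r : nat)
    (g : 'I_r -> {mpoly K[n]}) (H : {poly nat}) : Prop :=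
  forall i, has_dim (graded_piece g i) (H`_i)%R.

(* Row [j] of [L] lists the coefficients of the j-th linear form. *)
Definition linear_form (K : fieldType) (r n : nat) (L : 'M[K]_(r, n))
    (j : 'I_r) : {mpoly K[n]} :=
  \sum_(i < n) L j i *: 'X_i.

(* Zariski open subsets of the affine space of r x n matrices. *)
Definition zariski_open (K : fieldType) (r n : nat) (U : 'M[K]_(r, n) -> Prop)
    : Prop :=
  exists F : {mpoly K[r * n]} -> Prop,
    forall L, U L <-> exists2 f, F f & f.@[mxvec L 0] != 0.

(* Long division: the first m coefficients of the power series N / D, when
   the constant term of D is a unit. *)
Fixpoint series_div_seq (R : comUnitRingType) (N D : {poly R}) (m : nat)
    : seq R :=
  if m is k.+1 then
    let s := series_div_seq N D k in
    rcons s ((N`_k - \sum_(i < k) s`_i * D`_(k - i)) / D`_0)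
  else [::].

(* The coefficient of t^k in N / D. *)
Definition series_div_coef (R : comUnitRingType) (N D : {poly R}) (k : nat)
    : R :=
  (series_div_seq N D k.+1)`_k.

Lemma size_series_div_seq (R : comUnitRingType) (N D : {poly R}) m :
  size (series_div_seq N D m) = m.
Proof. by elim: m => //= m IHm; rewrite size_rcons IHm. Qed.

Lemma nth_series_div_seq (R : comUnitRingType) (N D : {poly R}) m k :
  (k < m)%N -> (series_div_seq N D m)`_k = series_div_coef N D k.
Proof.
elim: m => // m IHm; rewrite ltnS leq_eqVlt => /predU1P[-> //|lt_km] /=.
by rewrite nth_rcons size_series_div_seq lt_km IHm.
Qed.

Lemma series_divK (R : comUnitRingType) (N D : {poly R}) k :
  D`_0 \is a GRing.unit ->
  \sum_(i < k.+1) series_div_coef N D i * D`_(k - i) = N`_k.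
Proof.
move=> D0; rewrite big_ord_recr /= subnn {2}/series_div_coef /=.
rewrite nth_rcons size_series_div_seq ltnn eqxx divrK //.
under [X in _ - X]eq_bigr => i _ do rewrite nth_series_div_seq //.
by rewrite addrC subrK.
Qed.

(* Main.v *)
From HB Require Import structures.
Require Import Defs.
From mathcomp Require Import all_boot all_fingroup all_algebra.
From mathcomp Require Import boolp ring zify.
From mathcomp Require Import mpoly.

(* By Macaulay duality the degree [i] part of K[x] / (l_1^e_1, ..., l_r^e_r) is
   dual to the space of forms f = \sum_a c_a x^a of degree [i] that vanish to order
   at least [i + 1 - e_j] at the point [l_j]; below such a form is encoded by the
   functional F = \sum_a a! c_a x^a.  The Cremona transformation based at the first
   n points inverts exponents: in coordinates where these are the coordinate points,
   f is sent to \sum_a c_(b - a) x^a with b_j = e_j - 1, and the condition at a point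
   p with nonzero coordinates, \sum_a c_a p^a q(a) = 0 for all polynomials q of
   degree less than the multiplicity, becomes the same condition at 1/p.

   For seven points in P^3 with equal exponents, perform seven Cremona
   transformations, based at the complements of the lines of a Fano plane.  They
   turn degree [i] and exponent [d] into degree [28 (d - 1) - 13 i] and exponent
   [13 (d - 1) - 6 i + 1].  For [i = d0 + 1] the degree becomes negative, and for
   [i = d0] it becomes [d1 < 13].  There the conditions imposed by seven general
   points are independent: this is an open property, and it holds for three
   coordinate points together with the orbit of (1, 1, 1, 1) under sign changes. *)

Set Implicit Arguments.
Unset Strict Implicit.
Unset Printing Implicit Defensive.

Import GRing.Theory.
Local Open Scope ring_scope.

(** * Dimensions of subspaces *)

Section HasDim.
Variables (K : fieldType) (V V' : lmodType K).

Lemma has_dim_ext (W1 W2 : V -> Prop) m :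
  (forall v, W1 v <-> W2 v) -> has_dim W1 m -> has_dim W2 m.
Proof.
move=> eqW [v [Wv free_v gen_v]]; exists v; split=> // [i|w /eqW/gen_v //].
exact/eqW.
Qed.

(** Expressing one basis through the other gives a coefficient matrix with trivial left kernel, so
    it has at most as many rows as columns. *)
Lemma has_dim_le (W : V -> Prop) m m' : has_dim W m -> has_dim W m' -> (m <= m')%N.
Proof.
case=> v [Wv free_v _] [v' [_ _ gen_v']].
have [A vE] := choice (fun i => gen_v' _ (Wv i)).
pose M : 'M[K]_(m, m') := \matrix_(i, j) A i j.
suff /eqP <- : row_free M by apply: rank_leq_col.
have kerM (u : 'rV[K]_m) : u *m M = 0 -> u = 0.
  move=> uM0; apply/rowP=> i; rewrite mxE.
  apply: (free_v (fun i => u 0 i)).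
  under eq_bigr => k _ do rewrite vE scaler_sumr.
  rewrite exchange_big big1 //= => j _.
  under eq_bigr => k _ do rewrite scalerA.
  rewrite -scaler_suml; have := congr1 (fun w : 'rV_m' => w 0 j) uM0.
  rewrite !mxE; under eq_bigr => k _ do rewrite mxE.
  by move=> ->; rewrite scale0r.
rewrite -kermx_eq0; apply/eqP/row_matrixP=> k; rewrite row0; apply: kerM.
by rewrite -row_mul mulmx_ker row0.
Qed.

Lemma has_dim_uniq (W : V -> Prop) m m' : has_dim W m -> has_dim W m' -> m = m'.
Proof.
by move=> Wm Wm'; apply/eqP; rewrite eqn_leq !(has_dim_le (W := W)).
Qed.

Lemma has_dim_iso (W : V -> Prop) (W' : V' -> Prop) (T : {linear V -> V'}) (T'
  : {linear V' -> V}) m :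
    (forall w, W w -> W' (T w)) -> (forall w, W' w -> W (T' w)) ->
    (forall w, W w -> T' (T w) = w) -> (forall w, W' w -> T (T' w) = w) ->
  has_dim W m -> has_dim W' m.
Proof.
move=> WT WT' TK T'K [v [Wv free_v gen_v]].
exists (T \o v); split=> [i|c cv0|w W'w]; first exact/WT/Wv.
  apply: free_v; rewrite -[RHS](linear0 T') -cv0 linear_sum /=.
  by apply: eq_bigr => i _; rewrite linearZ /= TK.
have [c /(congr1 T)] := gen_v _ (WT' _ W'w).
rewrite T'K // linear_sum => ->; exists c.
by apply: eq_bigr => i _; rewrite linearZ.
Qed.

(** Serves the projection to a quotient, injective on a complement of the kernel but without a
    linear inverse at hand. *)
Lemma has_dim_image (W : V -> Prop) (W' : V' -> Prop) (T : {linear V -> V'}) m :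
    (forall a v w, W v -> W w -> W (a *: v + w)) -> W 0 ->
    (forall w, W w -> W' (T w)) -> (forall w, W w -> T w = 0 -> w = 0) ->
    (forall w', W' w' -> exists2 w, W w & w' = T w) ->
  has_dim W m -> has_dim W' m.
Proof.
move=> Wlin W0 WT injT surjT [v [Wv free_v gen_v]].
exists (T \o v); split=> [i|c cv0|w' W'w']; first exact/WT/Wv.
  apply: free_v; apply: injT.
    elim/big_ind: _ => // [x y Wx Wy|i _].
      by have := Wlin 1 x y Wx Wy; rewrite scale1r.
    by have := Wlin (c i) (v i) 0 (Wv i) W0; rewrite addr0.
  by rewrite linear_sum -[RHS]cv0; apply: eq_bigr => i _; rewrite linearZ.
have [w /gen_v[c ->] ->] := surjT _ W'w'; exists c.
by rewrite linear_sum; apply: eq_bigr => i _; rewrite linearZ.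
Qed.

End HasDim.

Lemma has_dim0 (K : fieldType) (V : lmodType K) :
  has_dim (fun v : V => v = 0) 0.
Proof.
by exists (fun=> 0); split=> [[]//|c _ []//|w ->]; exists (fun=> 0);
  rewrite big_ord0.
Qed.

Lemma has_dim_rowspace (K : fieldType) m n (A : 'M[K]_(m, n)) :
  has_dim (fun v : 'rV[K]_n => (v <= A)%MS) (\rank A).
Proof.
exists (fun i => row i (row_base A)); split=> [i|c|w].
- by rewrite (submx_trans (row_sub _ _)) // eq_row_base.
- move=> c0 i; pose u := \row_i c i; suff /rowP/(_ i) : u = 0 by rewrite !mxE.
  apply: (row_free_inj (row_base_free A)); rewrite mul0mx mulmx_sum_row -[RHS]c0.
  by apply: eq_bigr => j _; rewrite mxE.
- rewrite -(eq_row_base A) => /submxP[u ->]; exists (fun i => u 0 i).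
  by rewrite mulmx_sum_row.
Qed.

(** * Homogeneous polynomials as row vectors *)

Definition mons n i : seq 'X_{1..n} :=
  [seq s2m t | t : i.-tuple 'I_n <- enum (basis n i)].

Lemma mem_mons n i (a : 'X_{1..n}) : (a \in mons n i) = (mdeg a == i).
Proof. by rewrite basis_cover. Qed.

Lemma mons_uniq n i : uniq (mons n i).
Proof. exact: uniq_basis. Qed.

Lemma size_mons n i : size (mons n.+1 i) = 'C(i + n, i).
Proof. exact: size_basis. Qed.

(* Pairing of coefficients; [F] plays the role of a linear functional. *)
Definition mdot (K : fieldType) n (F f : {mpoly K[n]}) : K :=
  \sum_(a <- msupp F) F@_a * f@_a.

Lemma quot_pi0 (K : fieldType) n r (g : 'I_r -> {mpoly K[n]}) :
  quot_pi g 0 = 0.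
Proof. by apply: (addrI (quot_pi g 0)); rewrite -quot_piD !addr0. Qed.

Section HomogCoord.
Variables (K : fieldType) (n i : nat).
Local Notation N := (size (mons n i)).
Local Notation mon t := (nth 0%MM (mons n i) t).
Implicit Types (p F f : {mpoly K[n]}) (v : 'rV[K]_N).

Definition of_row v : {mpoly K[n]} := \sum_(t < N) v 0 t *: 'X_[mon t].

Fact of_row_is_linear : linear of_row.
Proof.
move=> c u v; rewrite /of_row scaler_sumr -big_split /=.
by apply: eq_bigr => t _; rewrite !mxE scalerDl scalerA.
Qed.

HB.instance Definition _ :=
  GRing.isLinear.Build K 'rV[K]_N {mpoly K[n]} _ of_row of_row_is_linear.

Definition to_row p : 'rV[K]_N := \row_t p@_(mon t).

Fact to_row_is_linear : linear to_row.
Proof. by move=> c u v; apply/rowP=> t; rewrite !mxE mcoeffD mcoeffZ. Qed.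

HB.instance Definition _ :=
  GRing.isLinear.Build K {mpoly K[n]} 'rV[K]_N _ to_row to_row_is_linear.

Lemma mcoeff_of_row v (t : 'I_N) : (of_row v)@_(mon t) = v 0 t.
Proof.
rewrite raddf_sum (bigD1 t) //= mcoeffZ mcoeffX eqxx mulr1 big1 ?addr0 //.
move=> u ut; rewrite mcoeffZ mcoeffX nth_uniq ?mons_uniq //.
by rewrite (inj_eq val_inj) (negPf ut) mulr0.
Qed.

Lemma of_rowK : cancel of_row to_row.
Proof. by move=> v; apply/rowP=> t; rewrite mxE mcoeff_of_row. Qed.

Lemma of_row_homog v : of_row v \is i.-homog.
Proof.
apply: rpred_sum => t _; apply: dhomogZ; rewrite dhomogX /=.
by rewrite -mem_mons mem_nth.
Qed.

Lemma sum_mons (R : nmodType) (G : 'X_{1..n} -> R) :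
  \sum_(a <- mons n i) G a = \sum_(t < N) G (mon t).
Proof. by rewrite (big_nth 0%MM) big_mkord. Qed.

Lemma sum_msupp_homog (R : nmodType) (G : 'X_{1..n} -> R) p :
    p \is i.-homog -> (forall a, p@_a = 0 -> G a = 0) ->
  \sum_(a <- msupp p) G a = \sum_(a <- mons n i) G a.
Proof.
move=> hp G0; apply: esym.
rewrite (bigID (fun a => a \in msupp p)) /= [X in _ + X]big1 => [|a]; last first.
  by move/memN_msupp_eq0/G0.
rewrite addr0 -big_filter; apply: perm_big; apply: uniq_perm.
- by rewrite filter_uniq ?mons_uniq.
- exact: msupp_uniq.
move=> a; rewrite mem_filter mem_mons andb_idr // => /(dhomogP _ _ _ hp) /= ->.
exact: eqxx.
Qed.

Lemma to_rowK p : p \is i.-homog -> of_row (to_row p) = p.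
Proof.
move=> hp; rewrite [RHS]mpolyE (sum_msupp_homog hp) => [|a ->]; last first.
  by rewrite scale0r.
by rewrite sum_mons; apply: eq_bigr => t _; rewrite mxE.
Qed.

Lemma mdot_of_row v f : mdot (of_row v) f = \sum_(t < N) v 0 t * f@_(mon t).
Proof.
rewrite /mdot (sum_msupp_homog (of_row_homog v)) => [|a ->]; last first.
  by rewrite mul0r.
by rewrite sum_mons; apply: eq_bigr => t _; rewrite mcoeff_of_row.
Qed.

Variable P : seq {mpoly K[n]}.
Hypothesis P_homog : forall p, p \in P -> p \is i.-homog.

Definition coef_mx : 'M[K]_(size P, N) :=
  \matrix_(x, t) (P`_x)@_(mon t).

Definition in_span p := exists c : 'I_(size P) -> K, p = \sum_x c x *: P`_x.

Lemma of_row_coef_mx (u : 'rV[K]_(size P)) :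
  of_row (u *m coef_mx) = \sum_x u 0 x *: P`_x.
Proof.
rewrite mulmx_sum_row linear_sum; apply: eq_bigr => x _; rewrite linearZ /=.
congr (_ *: _); rewrite -[RHS]to_rowK ?P_homog ?mem_nth //.
by congr of_row; apply/rowP=> t; rewrite !mxE.
Qed.

Lemma in_span_row p : p \is i.-homog ->
  in_span p <-> (to_row p <= coef_mx)%MS.
Proof.
move=> hp; split=> [[c ->]|/submxP[u uE]].
  apply/submxP; exists (\row_x c x); rewrite -[RHS]of_rowK. rewrite of_row_coef_mx.
  by congr to_row; apply: eq_bigr => x _; rewrite mxE.
by exists (fun x => u 0 x); rewrite -of_row_coef_mx -uE to_rowK.
Qed.

Lemma in_span_homog p : in_span p -> p \is i.-homog.
Proof.
by case=> c ->; apply: rpred_sum => x _; apply/dhomogZ/P_homog/mem_nth.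
Qed.

Lemma has_dim_in_span : has_dim in_span (\rank coef_mx).
Proof.
apply: (has_dim_iso (T := of_row) (T' := to_row)) (has_dim_rowspace coef_mx).
- by move=> v vM; apply/in_span_row; rewrite ?of_row_homog ?of_rowK.
- by move=> p hp; apply/in_span_row => //; apply: in_span_homog.
- by move=> v _; apply: of_rowK.
- by move=> p hp; apply: to_rowK; apply: in_span_homog.
Qed.

Lemma has_dim_annihilator :
  has_dim (fun F => F \is i.-homog /\ forall f, f \in P -> mdot F f = 0)
          (N - \rank coef_mx).
Proof.
have := has_dim_rowspace (kermx coef_mx^T); rewrite mxrank_ker mxrank_tr.
apply: (has_dim_iso (T := of_row) (T' := to_row)).
- move=> v /sub_kermxP v0; split; first exact: of_row_homog.
  move=> f fP; rewrite mdot_of_row.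
  have ix : (index f P < size P)%N by rewrite index_mem.
  have := congr1 (fun w : 'rV_(size P) => w 0 (Ordinal ix)) v0; rewrite !mxE => v0f.
  by rewrite -[RHS]v0f; apply: eq_bigr => t _; rewrite !mxE /= nth_index.
- move=> F [hF F0]; apply/sub_kermxP/rowP=> x; rewrite !mxE.
  rewrite -[RHS](F0 _ (mem_nth 0 (ltn_ord x))) -{2}(to_rowK hF) mdot_of_row.
  by apply: eq_bigr => t _; rewrite !mxE.
- by move=> v _; apply: of_rowK.
- by move=> F [hF _]; apply: to_rowK.
Qed.

(** On a complement of the row space of [coef_mx], the projection to the quotient algebra is a
    bijection onto the graded piece. *)
Lemma has_dim_graded_piece (r : nat) (g : 'I_r -> {mpoly K[n]}) :
    (forall p, p \is i.-homog -> in_ideal g p <-> in_span p) ->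
  has_dim (graded_piece g i) (N - \rank coef_mx).
Proof.
move=> gP; rewrite -mxrank_compl.
have quot0 p : p \is i.-homog -> quot_pi g p = 0 -> (to_row p <= coef_mx)%MS.
  move=> hp p0; apply/in_span_row => //; apply/gP => //.
  have := quot_piE g p 0; rewrite subr0 -[_ \in _]/(in_ideal g p) => <-.
  by rewrite p0 quot_pi0.
pose T v := quot_pi g (of_row v).
have linT : linear T.
  by move=> a u v; rewrite /T linearP quot_piD quot_piZ.
pose Tl := HB.pack_for {linear 'rV[K]_N -> quot_alg g} T
  (GRing.isLinear.Build K 'rV[K]_N (quot_alg g) _ T linT).
apply: (has_dim_image (T := Tl)) (has_dim_rowspace _).
- by move=> a u v hu hv; rewrite addmx_sub ?scalemx_sub.
- exact: sub0mx.
- by move=> v _; exists (of_row v) => //; apply: of_row_homog.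
- move=> v vC /(quot0 _ (of_row_homog v)); rewrite of_rowK => vM.
  apply/eqP; rewrite -submx0 -(capmx_compl coef_mx).
  by rewrite sub_capmx vM.
- move=> w [f hf ->].
  have : (to_row f <= coef_mx + coef_mx^C)%MS.
    by rewrite (submx_full _ (addsmx_compl_full _)).
  case/sub_addsmxP=> [[u1 u2]] /= fE; exists (u2 *m coef_mx^C)%MS.
    exact: submxMl.
  apply/eqP; rewrite /= /T quot_piE.
  have -> : f - of_row (u2 *m coef_mx^C)%MS = of_row (u1 *m coef_mx).
    by rewrite -{1}(to_rowK hf) fE linearD addrK.
  apply/gP; first exact: of_row_homog.
  by apply/in_span_row; rewrite ?of_row_homog // of_rowK submxMl.
Qed.

End HomogCoord.

(** * Inverse systems of powers of linear forms *)

Section IdealPiece.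
Variables (K : fieldType) (n r : nat) (g : 'I_r -> {mpoly K[n]}).
Variables (e : 'I_r -> nat) (i : nat).
Hypothesis g_homog : forall j, g j \is (e j).-homog.

(** Pairs (j, a) index the products g_j x^a of degree [i]. The test [e j <= i] prevents truncated
    subtraction from producing degree 0. *)
Definition ideal_rels : seq ('I_r * 'X_{1..n}) :=
  [seq (j, a) | j <- enum 'I_r,
                a <- if (e j <= i)%N then mons n (i - e j) else [::]].

Definition ideal_gens : seq {mpoly K[n]} :=
  [seq g x.1 * 'X_[x.2] | x <- ideal_rels].

Lemma mem_ideal_rels x : (x \in ideal_rels) = (mdeg x.2 + e x.1 == i)%N.
Proof.
apply/allpairsPdep/eqP => [[j [a [_ + ->]]]|<- /=].
  by case: leqP => //= eji; rewrite mem_mons => /eqP ->; rewrite subnK.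
exists x.1, x.2; split; rewrite ?mem_enum -?surjective_pairing //.
by rewrite leq_addl mem_mons addnK.
Qed.

Lemma ideal_gensP f :
  reflect (exists j a, (mdeg a + e j)%N = i /\ f = g j * 'X_[a])
          (f \in ideal_gens).
Proof.
apply: (iffP mapP) => [[x]|[j [a [ai ->]]]].
  by rewrite mem_ideal_rels => /eqP xi ->; exists x.1, x.2.
by exists (j, a); rewrite // mem_ideal_rels /= ai.
Qed.

Lemma ideal_gens_homog f : f \in ideal_gens -> f \is i.-homog.
Proof.
case/ideal_gensP=> j [a [<- ->]]; rewrite addnC; apply: dhomogM => //.
by rewrite dhomogX.
Qed.

(** Taking coordinates in degree [i] kills every term [g j * 'X_[a]] of another degree, so only
    scalar multiples of the products in [ideal_gens] remain. *)
Lemma in_ideal_span p : p \is i.-homog ->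
  in_ideal g p <-> in_span ideal_gens p.
Proof.
move=> hp; split=> [/asboolP[c pE]|[c ->]]; last first.
  apply/asboolP.
  have gE (x : 'I_(size ideal_gens)) := ideal_gensP _ (mem_nth 0 (ltn_ord x)).
  have [j /choice [a jaE]] := choice gE.
  exists (fun j0 => \sum_(x | j x == j0) c x *: 'X_[a x]).
  rewrite (partition_big j predT) //=; apply: eq_bigr => j0 _.
  rewrite mulr_suml; apply: eq_bigr => x /eqP <-.
  by have [_ ->] := jaE x; rewrite -scalerAl mulrC.
apply/(in_span_row ideal_gens_homog hp); rewrite pE linear_sum.
apply: summx_sub => j _; rewrite [c j]mpolyE mulr_suml linear_sum.
apply: summx_sub => a _; rewrite -scalerAl linearZ scalemx_sub //= mulrC.
have [ai|ai] := eqVneq (mdeg a + e j)%N i.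
  apply/(in_span_row ideal_gens_homog).
    by apply: ideal_gens_homog; apply/ideal_gensP; exists j, a.
  have gP : g j * 'X_[a] \in ideal_gens by apply/ideal_gensP; exists j, a.
  have ix : (index (g j * 'X_[a])%R ideal_gens < size ideal_gens)%N.
    by rewrite index_mem.
  exists (fun x => (x == Ordinal ix)%:R).
  rewrite (bigD1 (Ordinal ix)) //= eqxx scale1r nth_index // big1 ?addr0 //.
  by move=> x /negPf ->; rewrite scale0r.
rewrite (_ : to_row _ _ = 0) ?sub0mx //; apply/rowP=> t; rewrite !mxE.
have gh : g j * 'X_[a] \is (e j + mdeg a).-homog.
  by apply: dhomogM => //; rewrite dhomogX.
apply: (dhomog_nemf_coeff gh); rewrite /= addnC.
have /eqP -> : mdeg (nth 0%MM (mons n i) t) == i by rewrite -mem_mons mem_nth.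
by rewrite eq_sym.
Qed.

End IdealPiece.

(** * Linear forms and changes of coordinates *)

Section LinearForms.
Variables (K : fieldType) (n : nat).

Lemma linear_form_homog r (L : 'M[K]_(r, n)) j : linear_form L j \is 1.-homog.
Proof. by apply: rpred_sum => k _; apply: dhomogZ; rewrite dhomogX /= mdeg1. Qed.

Lemma linear_form_exp_homog r (L : 'M[K]_(r, n)) j d :
  linear_form L j ^+ d \is d.-homog.
Proof. by have := dhomogMn d (linear_form_homog L j); rewrite mul1n. Qed.

Definition subst_mx (A : 'M[K]_n) (p : {mpoly K[n]}) : {mpoly K[n]} :=
  p \mPo [tuple linear_form A i | i < n].

HB.instance Definition _ (A : 'M[K]_n) :=
  GRing.RMorphism.copy (subst_mx A) (comp_mpoly [tuple linear_form A i | i < n]).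
HB.instance Definition _ (A : 'M[K]_n) :=
  GRing.Linear.copy (subst_mx A) (comp_mpoly [tuple linear_form A i | i < n]).

Lemma subst_mxX (A : 'M[K]_n) i : subst_mx A 'X_i = linear_form A i.
Proof. by rewrite /subst_mx comp_mpolyXU -tnth_nth tnth_mktuple. Qed.

Lemma subst_mx_linear_form r (L : 'M[K]_(r, n)) (A : 'M[K]_n) j :
  subst_mx A (linear_form L j) = linear_form (L *m A) j.
Proof.
rewrite /linear_form linear_sum /=.
under eq_bigr => k _ do rewrite linearZ /= subst_mxX /linear_form scaler_sumr.
rewrite exchange_big; apply: eq_bigr => l _; rewrite mxE scaler_suml.
by apply: eq_bigr => k _; rewrite scalerA.
Qed.

Lemma linear_form1 (i : 'I_n) : linear_form (1%:M : 'M[K]_n) i = 'X_i.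
Proof.
rewrite /linear_form (bigD1 i) //= mxE eqxx scale1r big1 ?addr0 // => j ji.
by rewrite mxE eq_sym (negPf ji) scale0r.
Qed.

Lemma subst_mx_homog (A : 'M[K]_n) i p :
  p \is i.-homog -> subst_mx A p \is i.-homog.
Proof.
move=> hp; rewrite /subst_mx comp_mpolyE big_seq; apply: rpred_sum => a aP.
apply: dhomogZ; rewrite -[i](dhomogP _ _ _ hp _ aP) /= mdegE.
apply: (big_ind2 (fun p k => p \is k.-homog)) => [|p1 k1 p2 k2|k _].
- by rewrite dhomog1.
- exact: dhomogM.
- by rewrite tnth_mktuple linear_form_exp_homog.
Qed.

Lemma subst_mxK (A B : 'M[K]_n) : A *m B = 1%:M -> cancel (subst_mx A) (subst_mx B).
Proof.
move=> AB p; rewrite [RHS]mpolyE [X in subst_mx B X]comp_mpolyE linear_sum /=.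
apply: eq_bigr => a _; rewrite linearZ rmorph_prod mpolyXE_id /=.
congr (_ *: _); apply: eq_bigr => i _; rewrite rmorphXn /= tnth_mktuple.
by rewrite subst_mx_linear_form AB linear_form1.
Qed.

Lemma subst_mx_in_ideal r (g : 'I_r -> {mpoly K[n]}) A p :
  in_ideal g p -> in_ideal (fun j => subst_mx A (g j)) (subst_mx A p).
Proof.
move=> /asboolP[c ->]; apply/asboolP; exists (fun j => subst_mx A (c j)).
by rewrite linear_sum; apply: eq_bigr => j _; rewrite rmorphM.
Qed.

End LinearForms.

(** * Inverse systems with integer degrees and exponents *)

Definition truncz (z : int) : nat := if z is Posz k then k else 0.

(** Cremona transformations can make the degree negative; only the zero form lives there. *)
Definition homogz (K : fieldType) n (i : int) (F : {mpoly K[n]}) : Prop :=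
  if i is Posz k then F \is k.-homog : Prop else F = 0.

(* The degree [i] part of the inverse system of the ideal generated by the
   powers [l_j ^ (e j)]; a nonpositive [e j] stands for the unit ideal. *)
Definition inv_sys (K : fieldType) r n (L : 'M[K]_(r, n)) (i : int)
    (e : 'I_r -> int) (F : {mpoly K[n]}) : Prop :=
  homogz i F /\ forall j a, (mdeg a + truncz (e j))%:Z = i ->
    mdot F (linear_form L j ^+ truncz (e j) * 'X_[a]) = 0.

Section InvSys.
Variables (K : fieldType) (n r : nat).
Implicit Types (L : 'M[K]_(r, n)) (e : 'I_r -> int).

Local Notation gens L e i :=
  (ideal_gens (fun j => linear_form L j ^+ truncz (e j)) (truncz \o e) i).
Local Notation rk L e i := (\rank (coef_mx i (gens L e i))).

Lemma pow_homog L e j :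
  linear_form L j ^+ truncz (e j) \is ((truncz \o e) j).-homog.
Proof. exact: linear_form_exp_homog. Qed.

Lemma has_dim_inv_sys L i e :
  has_dim (inv_sys L (Posz i) e) (size (mons n i) - rk L e i).
Proof.
have := has_dim_annihilator i (gens L e i).
apply: has_dim_ext => F; split=> [[hF F0]|[hF F0]]; split=> //.
  move=> j a /= [ai]; apply: F0; apply/ideal_gensP.
  by exists j, a.
by move=> f /ideal_gensP[j [a [/= ai ->]]]; apply: F0; rewrite ai.
Qed.

Lemma has_dim_inv_sys_neg L k e m :
  has_dim (inv_sys L (Negz k) e) m <-> m = 0%N.
Proof.
have W0 : has_dim (inv_sys L (Negz k) e) 0.
  by apply: has_dim_ext (has_dim0 _) => F; split=> [->|[]].
by split=> [/has_dim_uniq/(_ W0)|->].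
Qed.

(** Macaulay duality at the level of dimensions: both are the number of monomials minus the rank of
    the same coefficient matrix. *)
Lemma has_dim_graded_inv_sys L i (e : 'I_r -> nat) m :
    has_dim (inv_sys L (Posz i) (fun j => Posz (e j))) m ->
  has_dim (graded_piece (fun j => linear_form L j ^+ e j) i) m.
Proof.
move=> /has_dim_uniq/(_ (has_dim_inv_sys _ _ _)) ->.
have hom := pow_homog L (fun j => Posz (e j)).
apply: (has_dim_graded_piece (ideal_gens_homog (i := i) hom)) => p hp.
exact: (in_ideal_span hom).
Qed.

(** Substitution acts on the ideal rather than on the functionals, so the ranks are compared through
    the spans of the generators, carried over by [A] and back by its inverse. *)
Lemma has_dim_inv_sys_mulmx L A i e m : A \in unitmx ->
  has_dim (inv_sys L i e) m -> has_dim (inv_sys (L *m A) i e) m.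
Proof.
move=> Au; case: i => [i|k];
  last by move/has_dim_inv_sys_neg/has_dim_inv_sys_neg; apply.
move=> /has_dim_uniq/(_ (has_dim_inv_sys _ _ _)) ->.
suff -> : rk L e i = rk (L *m A) e i by apply: has_dim_inv_sys.
have hom L' := ideal_gens_homog (i := i) (pow_homog L' e).
apply: (has_dim_uniq (W := in_span (gens (L *m A) e i))); last first.
  exact/has_dim_in_span/hom.
have spanP L' := in_ideal_span (i := i) (pow_homog L' e).
have step L1 B p : in_span (gens L1 e i) p ->
    in_span (gens (L1 *m B) e i) (subst_mx B p).
  move=> pS; have hp := in_span_homog (hom _) pS.
  apply/spanP; first exact: subst_mx_homog.
  have /(subst_mx_in_ideal B) :=  (spanP _ _ hp).2 pS.
  congr (is_true (in_ideal _ _)); apply/funext=> j.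
  by rewrite rmorphXn /= subst_mx_linear_form.
apply: (has_dim_iso (T := subst_mx A) (T' := subst_mx (invmx A)))
  (has_dim_in_span (hom _)).
- by move=> p; apply: step.
- by move=> p /(step _ (invmx A)); rewrite mulmxK.
- by move=> p _; apply: subst_mxK; rewrite mulmxV.
- by move=> p _; apply: subst_mxK; rewrite mulVmx.
Qed.

End InvSys.

(** * Vanishing conditions at points of the torus *)

Lemma ltn_truncz k z : (k < truncz z)%N = (Posz k < z)%R.
Proof. by case: z => // z. Qed.

Lemma truncz_subn m k : truncz (Posz m - Posz k) = (m - k)%N.
Proof.
by have [km|/ltnW mk] := leqP k m;
  [rewrite subzn | rewrite -opprB subzn //= (eqP mk); case: (k - m)%N].
Qed.

Section Multinomials.
Variable n : nat.
Implicit Types a b c : 'X_{1..n}.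

Definition mnm_fact a : nat := \prod_j (a j)`!.
Definition mnm_bin a c : nat := \prod_j 'C(a j, c j).

Lemma mnm_fact_gt0 a : (0 < mnm_fact a)%N.
Proof. by apply: prodn_gt0 => j; apply: fact_gt0. Qed.

Lemma mnm_factS a j : mnm_fact (a + U_(j)) = ((a j).+1 * mnm_fact a)%N.
Proof.
rewrite /mnm_fact (bigD1 j) // [in RHS](bigD1 j) //=.
rewrite mnmDE mnm1E eqxx addn1 factS mulnA; congr (_ * _)%N; apply: eq_bigr => k kj.
by rewrite mnmDE mnm1E eq_sym (negPf kj) addn0.
Qed.

Lemma mnm_bin_fact a c : (c <= a)%MM ->
  (mnm_bin a c * (mnm_fact c * mnm_fact (a - c)) = mnm_fact a)%N.
Proof.
move=> /forallP ca; rewrite /mnm_bin /mnm_fact -!big_split /=.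
by apply: eq_bigr => j _; rewrite mnmBE bin_fact.
Qed.

Lemma mnm_bin_small a c : ~~ (c <= a)%MM -> mnm_bin a c = 0%N.
Proof.
case/forallPn=> j; rewrite -ltnNge => aj.
by rewrite /mnm_bin (bigD1 j) //= bin_small.
Qed.

Lemma mnm_binnn a : mnm_bin a a = 1%N.
Proof. by rewrite /mnm_bin big1 // => j _; rewrite binn. Qed.

Lemma bin_mul x l : (x * 'C(x, l) = l * 'C(x, l) + l.+1 * 'C(x, l.+1))%N.
Proof.
rewrite mul_bin_left -mulnDl; have [/subnKC->//|xl] := leqP l x.
by rewrite bin_small ?muln0.
Qed.

Lemma mnm_bin_mul a c j :
  (a j * mnm_bin a c = c j * mnm_bin a c + (c j).+1 * mnm_bin a (c + U_(j)))%N.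
Proof.
have binE c' : mnm_bin a c' = ('C(a j, c' j) * \prod_(k | k != j) 'C(a k, c' k))%N.
  by rewrite /mnm_bin (bigD1 j).
rewrite !binE mnmDE mnm1E eqxx addn1.
rewrite [X in (_ = _ + _.+1 * (_ * X))%N](eq_bigr (fun k => 'C(a k, c k))) /=.
  by rewrite !mulnA -mulnDl bin_mul.
by move=> k kj; rewrite mnmDE mnm1E eq_sym (negPf kj) addn0.
Qed.

Lemma lem_mdeg_eq a c : (c <= a)%MM -> mdeg c = mdeg a -> c = a.
Proof.
move=> ca; rewrite -{1}(submK ca) mdegD => /eqP.
rewrite -{1}[mdeg c]add0n eqn_add2r eq_sym mdeg_eq0 => /eqP ac0.
by rewrite -[RHS](submK ca) ac0 add0m.
Qed.

End Multinomials.

Section Torus.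
Variables (K : fieldType) (n : nat).
Hypothesis charK0 : [pchar K] =i pred0.
Implicit Types (a b c : 'X_{1..n}) (p : 'I_n -> K) (F : {mpoly K[n]}).

Lemma natr_pchar0_neq0 k : (0 < k)%N -> k%:R != 0 :> K.
Proof. by move=> k0; have /pcharf0P -> := charK0; rewrite -lt0n. Qed.

Lemma natr_inj_pchar0 : injective (fun k : nat => k%:R : K).
Proof.
move=> k l /eqP; wlog kl : k l / (k <= l)%N => [wlog_kl|].
  by have [/wlog_kl//|/ltnW/wlog_kl lk] := leqP k l; rewrite eq_sym => /lk ->.
have /pcharf0P c0 := charK0.
rewrite eq_sym -subr_eq0 -natrB // c0 subn_eq0 => lk.
by apply/eqP; rewrite eqn_leq kl.
Qed.

Lemma mnm_fact_neq0 a : (mnm_fact a)%:R != 0 :> K.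
Proof. exact/natr_pchar0_neq0/mnm_fact_gt0. Qed.

Definition mnm_pow p a : K := \prod_j p j ^+ a j.

Lemma mnm_powD p a c : mnm_pow p (a + c) = mnm_pow p a * mnm_pow p c.
Proof. by rewrite -big_split; apply: eq_bigr => j _; rewrite mnmDE exprD. Qed.

Lemma mnm_powU p j : mnm_pow p U_(j) = p j.
Proof.
rewrite /mnm_pow (bigD1 j) //= mnm1E eqxx expr1 big1 ?mulr1 // => k kj.
by rewrite mnm1E eq_sym (negPf kj) expr0.
Qed.

Lemma mnm_pow_neq0 p a : (forall j, p j != 0) -> mnm_pow p a != 0.
Proof. by move=> p0; apply/prodf_neq0 => j _; rewrite expf_neq0. Qed.

Lemma mnm_powV p a : mnm_pow (fun j => (p j)^-1) a = (mnm_pow p a)^-1.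
Proof. by rewrite /mnm_pow -prodfV; apply: eq_bigr => j _; rewrite exprVn. Qed.

Lemma mcoeff_mulX F a c :
  (F * 'X_[c])@_a = if (c <= a)%MM then F@_(a - c) else 0.
Proof.
case: ifP => [ca|/negP ca]; first by rewrite -{1}(submK ca) addmC mcoeffMX.
apply: memN_msupp_eq0; rewrite (perm_mem (msuppMX _ _)).
by apply/mapP=> -[a' _ aE]; apply: ca; rewrite aE lem_addr.
Qed.

(** The multinomial theorem with denominators cleared. *)
Lemma mcoeff_linear_form_exp r (L : 'M[K]_(r, n)) j e a : mdeg a = e ->
  (linear_form L j ^+ e)@_a * (mnm_fact a)%:R = e`!%:R * mnm_pow (L j) a.
Proof.
elim: e a => [|e IHe] a adeg.
  move/eqP: adeg; rewrite mdeg_eq0 => /eqP ->.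
  rewrite expr0 mcoeff1 eqxx mul1r /mnm_fact /mnm_pow !big1 ?mulr1 // => k _;
  by rewrite mnm0E.
rewrite exprSr {2}/linear_form mulr_sumr raddf_sum mulr_suml /=.
(* The factor e + 1 = |a| is split into the a_k, one for each variable that the last factor can
   contribute. *)
transitivity (\sum_k (a k)%:R * (e`!%:R * mnm_pow (L j) a)); last first.
  by rewrite -mulr_suml -natr_sum -mdegE adeg factS natrM mulrA.
apply: eq_bigr => k _; rewrite -scalerAr mcoeffZ mcoeff_mulX.
case: ifP => [ka|]; last first.
  by move/negbT; rewrite lep1mP negbK => /eqP ->; rewrite mulr0 !mul0r.
have aE : a = (a - U_(k) + U_(k))%MM by rewrite submK.
have ak : a k = ((a - U_(k))%MM k).+1 by rewrite {1}aE mnmDE mnm1E eqxx addn1.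
have := IHe (a - U_(k))%MM.
have -> : mdeg (a - U_(k)) = e.
  by apply/eqP; rewrite -eqSS -adeg [in X in _ == X]aE mdegD mdeg1 addn1.
move=> /(_ erefl) IH.
have factE : mnm_fact a = (((a - U_(k))%MM k).+1 * mnm_fact (a - U_(k)))%N.
  by rewrite {1}aE mnm_factS.
have powE : mnm_pow (L j) a = mnm_pow (L j) (a - U_(k)) * L j k.
  by rewrite {1}aE mnm_powD mnm_powU.
rewrite ak factE powE natrM.
transitivity (L j k * ((a - U_(k))%MM k).+1%:R *
  ((linear_form L j ^+ e)@_(a - U_(k)) * (mnm_fact (a - U_(k)))%:R)).
  by ring.
by rewrite IH; ring.
Qed.

(** Splits off a nonzero factor depending only on [c] and [e]; what is left is the summand of
    [torus_form] up to the coefficient of F. When c <= a fails, both sides vanish. *)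
Lemma mcoeff_linear_form_expX r (L : 'M[K]_(r, n)) j e a c :
    (forall k, L j k != 0) -> mdeg a = (mdeg c + e)%N ->
  (linear_form L j ^+ e * 'X_[c])@_a =
  e`!%:R * (mnm_fact c)%:R / mnm_pow (L j) c *
    (mnm_pow (L j) a * (mnm_bin a c)%:R / (mnm_fact a)%:R).
Proof.
move=> Lj0 adeg; rewrite mcoeff_mulX.
case: ifP => [ca|/negbT/mnm_bin_small ->]; last by rewrite mulr0 mul0r mulr0.
have acE : (a - c + c)%MM = a by rewrite submK.
have acdeg : mdeg (a - c) = e.
  by apply/eqP; rewrite -(eqn_add2r (mdeg c)) -mdegD acE adeg addnC.
have expE := mcoeff_linear_form_exp L j acdeg.
have := mnm_bin_fact ca => /(congr1 (fun k => k%:R : K)); rewrite !natrM => <-.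
have -> : mnm_pow (L j) a = mnm_pow (L j) (a - c) * mnm_pow (L j) c.
  by rewrite -mnm_powD acE.
have c0 := mnm_fact_neq0 c; have ac0 := mnm_fact_neq0 (a - c).
have p0 := mnm_pow_neq0 c Lj0.
have bin0 : (mnm_bin a c)%:R != 0 :> K.
  apply: natr_pchar0_neq0; have := mnm_fact_gt0 a; rewrite -(mnm_bin_fact ca).
  by rewrite muln_gt0 => /andP[].
have -> : (linear_form L j ^+ e)@_(a - c) =
    e`!%:R * mnm_pow (L j) (a - c) / (mnm_fact (a - c))%:R.
  by rewrite -expE mulfK.
by field; rewrite c0 ac0 p0 bin0.
Qed.

(** This is p^c times the divided derivative of index c, at p, of f = \sum_a (F_a / a!) x^a. The
    factor p^c leaves the dependence on [a] as p^a times a polynomial in the exponents. *)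
Definition torus_form F p c : K :=
  \sum_(a <- msupp F)
     F@_a / (mnm_fact a)%:R * mnm_pow p a * (mnm_bin a c)%:R.

(* If [p] has no zero coordinate: [\sum_a (F_a / a!) x^a] vanishes at [p] to order
   at least [m]. *)
Definition torus_cond F p m : Prop :=
  forall c, (mdeg c < m)%N -> torus_form F p c = 0.

Section OnePoint.
Variables (r : nat) (L : 'M[K]_(r, n)) (j : 'I_r).
Hypothesis Lj0 : forall k, L j k != 0.
Variables (i : nat) (F : {mpoly K[n]}).
Hypothesis Fi : F \is i.-homog.

Lemma mdot_linear_form_exp e c : (mdeg c + e)%N = i ->
  mdot F (linear_form L j ^+ e * 'X_[c]) =
  e`!%:R * (mnm_fact c)%:R / mnm_pow (L j) c * torus_form F (L j) c.
Proof.
move=> ci; rewrite /mdot /torus_form mulr_sumr big_seq [RHS]big_seq.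
apply: eq_bigr => a /(dhomogP _ _ _ Fi) /= adeg.
by rewrite mcoeff_linear_form_expX ?adeg //; ring.
Qed.

(** Euler's relation: for |a| = i, (i - |c|) binom(a, c) = \sum_k (c_k + 1) binom(a, c + u_k), and i
    - |c| is invertible. *)
Lemma torus_form_descent c : (mdeg c < i)%N ->
    (forall c', mdeg c' = (mdeg c).+1 -> torus_form F (L j) c' = 0) ->
  torus_form F (L j) c = 0.
Proof.
move=> ci F0; apply/eqP.
have ic0 : (i - mdeg c)%:R != 0 :> K by rewrite natr_pchar0_neq0 ?subn_gt0.
rewrite -(mulrI_eq0 _ (lregP ic0)); apply/eqP.
transitivity (\sum_k (c k).+1%:R * torus_form F (L j) (c + U_(k))); last first.
  by rewrite big1 // => k _; rewrite F0 ?mulr0 // mdegD mdeg1 addn1.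
rewrite /torus_form mulr_sumr.
under [RHS]eq_bigr => k _ do rewrite mulr_sumr.
rewrite exchange_big /= big_seq [RHS]big_seq; apply: eq_bigr => a.
move/(dhomogP _ _ _ Fi) => /= adeg.
transitivity (F@_a / (mnm_fact a)%:R * mnm_pow (L j) a *
  \sum_k ((c k).+1 * mnm_bin a (c + U_(k)))%:R).
  rewrite mulrCA; congr (_ * _); rewrite -natr_sum -natrM; congr _%:R.
  apply/eqP; rewrite mulnBl -(eqn_add2l (mdeg c * mnm_bin a c)) subnKC; last first.
    by rewrite leq_mul2r ltnW ?orbT.
  rewrite -adeg !mdegE !big_distrl -big_split /=; apply/eqP.
  by apply: eq_bigr => k _; rewrite mnm_bin_mul.
by rewrite mulr_sumr; apply: eq_bigr => k _; rewrite natrM; ring.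
Qed.

Lemma torus_cond_level k : (k <= i)%N ->
    (forall c, mdeg c = k -> torus_form F (L j) c = 0) ->
  torus_cond F (L j) k.+1.
Proof.
move=> ki F0 c; rewrite ltnS => ck.
have [m km] : exists m, (mdeg c + m)%N = k by exists (k - mdeg c)%N; rewrite subnKC.
elim: m c ck km => [|m IHm] c ck km; first by apply: F0; rewrite -km addn0.
apply: torus_form_descent => [|c' c'E].
  by apply: leq_trans ki; rewrite -km addnS ltnS leq_addr.
by apply: IHm; rewrite c'E ?addSnnS // -km addnS ltnS leq_addr.
Qed.

(** Among the monomials of degree |c|, only a = c has a nonzero binom(a, c). *)
Lemma torus_form_top c : mdeg c = i ->
  torus_form F (L j) c = F@_c / (mnm_fact c)%:R * mnm_pow (L j) c.
Proof.
move=> ci; rewrite /torus_form.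
have bin0 a : a \in msupp F -> a != c -> mnm_bin a c = 0%N.
  move=> aF ac; apply: mnm_bin_small; apply: contra ac => ca.
  by rewrite (lem_mdeg_eq ca) // ci; apply/esym; exact: (dhomogP _ _ _ Fi _ aF).
have [cF|cF] := boolP (c \in msupp F).
  rewrite (bigD1_seq c) //= mnm_binnn mulr1 big_seq_cond big1 ?addr0 // => a.
  by case/andP=> aF ac; rewrite bin0 // mulr0.
rewrite (memN_msupp_eq0 cF) !mul0r big_seq big1 // => a aF.
by rewrite bin0 ?mulr0 //; apply: contraNneq cF => <-.
Qed.

(** Pairing with l^e x^c is, up to a nonzero factor, a derivative of order exactly i - e at the
    point; Euler's relation supplies the lower orders. *)
Lemma linear_form_torus_cond (e : int) :
  (forall c, (mdeg c + truncz e)%:Z = Posz i ->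
     mdot F (linear_form L j ^+ truncz e * 'X_[c]) = 0) <->
  torus_cond F (L j) (truncz (Posz i + 1 - e)).
Proof.
have mdot0 c t : (mdeg c + t)%N = i ->
    mdot F (linear_form L j ^+ t * 'X_[c]) = 0 <-> torus_form F (L j) c = 0.
  move=> ci; rewrite mdot_linear_form_exp //; split=> [|->]; last by rewrite mulr0.
  move/eqP; rewrite mulf_eq0 => /orP[|/eqP //].
  rewrite !mulf_eq0 invr_eq0 (negPf (mnm_fact_neq0 c)) (negPf (mnm_pow_neq0 c Lj0)).
  by rewrite (negPf (natr_pchar0_neq0 (fact_gt0 t))).
split=> F0; last first.
  move=> c [ci]; apply/mdot0 => //; apply: F0.
  by rewrite ltn_truncz -ci; case: (e) => t /=; lia.
case: e F0 => [t|t] /= F0.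
  (* An exponent above the degree gives a nonpositive multiplicity, hence no condition. *)
  have [it|ti] := ltnP i t.
    by move=> c; rewrite ltn_truncz; lia.
  have -> : truncz (Posz i + 1 - Posz t) = (i - t).+1.
    by rewrite -[_ + 1]/(Posz (i + 1)) truncz_subn addn1 subSn.
  apply: torus_cond_level; first exact: leq_subr.
  by move=> c cE; apply/(mdot0 _ t); [lia|apply: F0; congr Posz; lia].
(* A negative exponent stands for the unit ideal: [F] pairs to zero with every monomial of its
   degree. *)
have {}F0 : F = 0.
  apply/mpolyP=> c; rewrite mcoeff0; have [ci|ci] := eqVneq (mdeg c) i; last first.
    exact: dhomog_nemf_coeff Fi ci.
  have /mdot0 : mdot F (linear_form L j ^+ 0 * 'X_[c]) = 0.
    by apply: F0; rewrite addn0 ci.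
  rewrite addn0 torus_form_top // => /(_ ci) /eqP.
  rewrite !mulf_eq0 invr_eq0 (negPf (mnm_fact_neq0 c)) (negPf (mnm_pow_neq0 c Lj0)).
  by rewrite !orbF => /eqP.
by move=> c _; rewrite /torus_form F0 msupp0 big_nil.
Qed.

End OnePoint.
End Torus.

(** * Inversion of exponents *)

Section BinInversion.
Variable K : fieldType.

(** As a polynomial in x of degree at most g, the left side expands in the binomial basis; x <= B
    keeps the subtraction exact. *)
Lemma bin_inversion B g : exists u : nat -> K,
  forall x, (x <= B)%N -> 'C(B - x, g)%:R = \sum_(l < g.+1) u l * 'C(x, l)%:R.
Proof.
(* These coefficients satisfy Pascal's rule, which carries the induction on x. *)
exists (fun l => (-1) ^+ l * 'C(B - l, g - l)%:R) => x.
elim: x B g => [|x IHx] B g xB.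
  rewrite big_ord_recl /= !subn0 bin0 expr0 mul1r mulr1 big1 ?addr0 // => l _.
  by rewrite bin0n mulr0.
case: B xB => // B xB; rewrite subSS IHx //.
have -> : \sum_(l < g.+1) (-1) ^+ l * 'C(B.+1 - l, g - l)%:R * 'C(x.+1, l)%:R =
    \sum_(l < g.+1) (-1) ^+ l * 'C(B.+1 - l, g - l)%:R * 'C(x, l)%:R +
    \sum_(l < g) (-1) ^+ l.+1 * 'C(B - l, g - l.+1)%:R * 'C(x, l)%:R :> K.
  rewrite [LHS]big_ord_recl [in RHS]big_ord_recl /= !bin0 -addrA; congr (_ + _).
  rewrite -big_split; apply: eq_bigr => l _ /=.
  by rewrite /bump leq0n add1n subSS binS natrD mulrDr.
rewrite [LHS]big_ord_recr [X in _ = X + _]big_ord_recr /= subnn !bin0 addrAC.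
congr (_ + _); rewrite -big_split; apply: eq_bigr => l _ /=.
have [xl|lx] := ltnP x l; first by rewrite (bin_small xl) !mulr0 addr0.
have lg := ltn_ord l.
have -> : (g - l)%N = (g - l.+1).+1 by rewrite subnSK.
rewrite (subSn (leq_trans lx xB)) binS natrD exprS.
by ring.
Qed.

End BinInversion.

Section Inversion.
Variables (K : fieldType) (n : nat).
Hypothesis charK0 : [pchar K] =i pred0.
Implicit Types (a b c : 'X_{1..n}) (p : 'I_n -> K) (F : {mpoly K[n]}).

(** The product of the one-variable expansions. The reflection a -> b - a thus preserves the degree
    bound on polynomials in the exponents, which is why inversion preserves multiplicities on the
    torus. *)
Lemma mnm_bin_inversion b c : exists (I : finType) (u : I -> K) (d : I -> 'X_{1..n}),
  (forall i, mdeg (d i) <= mdeg c)%N /\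
  forall a, (a <= b)%MM ->
    (mnm_bin (b - a) c)%:R = \sum_i u i * (mnm_bin a (d i))%:R.
Proof.
pose B := (mdeg c).+1.
have leB (j : 'I_n) : (c j < B)%N by rewrite ltnS mdegE (bigD1 j) //= leq_addr.
have /choice[u uE] := fun j => bin_inversion K (b j) (c j).
(* All coordinates share the index range below [B]; indices exceeding [c] somewhere get coefficient
   0. *)
pose P (f : {ffun 'I_n -> 'I_B}) := [forall j, (f j <= c j)%N].
exists {ffun 'I_n -> 'I_B}.
exists (fun f => if P f then \prod_j u j (f j) else 0).
exists (fun f => if P f then [multinom (f j : nat) | j < n] else 0%MM).
split=> [f|a /forallP ab].
  case: ifP => [/forallP fc|]; last by rewrite mdeg0.
  by rewrite !mdegE; apply: leq_sum => j _; rewrite mnmE.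
rewrite /mnm_bin natr_prod.
transitivity (\prod_(j < n) \sum_(l < B) (if (l <= c j)%N then u j l else 0) *
  'C(a j, l)%:R).
  apply: eq_bigr => j _; rewrite mnmBE uE //.
  rewrite (big_ord_widen_cond B xpredT (fun l => u j l * 'C(a j, l)%:R)); last first.
    exact: leB.
  rewrite big_mkcond; apply: eq_bigr => l _; rewrite /= ltnS.
  by case: ifP; rewrite ?mul0r.
rewrite bigA_distr_bigA /=; apply: eq_bigr => f _; rewrite big_split /=.
case: ifP => [/forallP fc|/negbT/forallPn[j fj]].
  rewrite natr_prod; congr (_ * _); apply: eq_bigr => j _; last by rewrite mnmE.
  by rewrite fc.
by rewrite (bigD1 j) //= (negPf fj) !mul0r.
Qed.

(** On f = \sum_a (F_a / a!) x^a this sends x^a to x^(b - a); the factorials come from the encoding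
    of f by F. The degree bound only provides a finite index type. *)
Definition invert_mpoly b F : {mpoly K[n]} :=
  \sum_(a : 'X_{1..n < (mdeg b).+1} | (a <= b)%MM)
     (F@_(b - a) * (mnm_fact a)%:R / (mnm_fact (b - a))%:R) *: 'X_[a].

Fact invert_mpoly_is_linear b : linear (invert_mpoly b).
Proof.
move=> k F G; rewrite /invert_mpoly scaler_sumr -big_split /=.
by apply: eq_bigr => a _; rewrite mcoeffD mcoeffZ scalerA -scalerDl !mulrDl !mulrA.
Qed.

HB.instance Definition _ b :=
  GRing.isLinear.Build K {mpoly K[n]} {mpoly K[n]} _ (invert_mpoly b)
    (invert_mpoly_is_linear b).

Lemma mcoeff_invert b F a : (invert_mpoly b F)@_a =
  if (a <= b)%MM then F@_(b - a) * (mnm_fact a)%:R / (mnm_fact (b - a))%:R else 0.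
Proof.
rewrite /invert_mpoly big_mkcond /=.
have E a' : (if (a' <= b)%MM then (F@_(b - a') * (mnm_fact a')%:R /
    (mnm_fact (b - a'))%:R) *: 'X_[a'] else 0 : {mpoly K[n]}) =
  (if (a' <= b)%MM then F@_(b - a') * (mnm_fact a')%:R / (mnm_fact (b - a'))%:R
   else 0) *: 'X_[a'] by case: ifP; rewrite ?scale0r.
under eq_bigr => a' _ do rewrite E.
have [ab|ab] := leqP (mdeg a) (mdeg b).
  exact: (mcoeff_mpoly (fun a' => if (a' <= b)%MM then
    F@_(b - a') * (mnm_fact a')%:R / (mnm_fact (b - a'))%:R else 0)).
rewrite raddf_sum big1 /= => [|[a' /= a'b] _].
  by case: ifP => // /submK abE; move: ab; rewrite -abE mdegD ltnNge leq_addl.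
rewrite mcoeffZ mcoeffX; case: eqP => [aE|]; last by rewrite mulr0.
by move: a'b; rewrite aE ltnS leqNgt ab.
Qed.

Lemma subKm a b : (a <= b)%MM -> (b - (b - a) = a)%MM.
Proof. by move/mnm_lepP=> ab; apply/mnmP=> j; rewrite !mnmBE subKn. Qed.

Lemma lem_subr a b : (b - a <= b)%MM.
Proof. by apply/mnm_lepP=> j; rewrite mnmBE leq_subr. Qed.

Section Support.
Variables (b : 'X_{1..n}) (F : {mpoly K[n]}).
Hypothesis suppF : forall a, a \in msupp F -> (a <= b)%MM.

Lemma msupp_invert :
  perm_eq (msupp (invert_mpoly b F)) [seq (b - a)%MM | a <- msupp F].
Proof.
apply: uniq_perm; first exact: msupp_uniq.
  rewrite map_inj_in_uniq ?msupp_uniq // => x y /suppF xb /suppF yb /(congr1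
    (mnm_sub b)).
  by rewrite !subKm.
move=> a; rewrite mcoeff_msupp mcoeff_invert; apply/idP/mapP.
  case: ifP => [ab|]; last by rewrite eqxx.
  rewrite !mulf_eq0 !negb_or -mcoeff_msupp -andbA => /andP[aF _].
  by exists (b - a)%MM; rewrite ?subKm.
case=> c cF ->; rewrite lem_subr subKm ?suppF //.
by rewrite !mulf_neq0 ?invr_eq0 ?mnm_fact_neq0 // -mcoeff_msupp.
Qed.

Lemma invert_mpolyK : invert_mpoly b (invert_mpoly b F) = F.
Proof.
apply/mpolyP=> a; rewrite !mcoeff_invert; case: ifP => [ab|/negP ab].
  rewrite lem_subr subKm // -!mulrA [_^-1 * (_ / _)]mulrCA mulVKf ?mnm_fact_neq0 //.
  by rewrite divff ?mnm_fact_neq0 // mulr1.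
by apply/esym/memN_msupp_eq0; apply/negP=> /suppF.
Qed.

Lemma torus_cond_invert p m : (forall j, p j != 0) ->
  torus_cond F p m -> torus_cond (invert_mpoly b F) (fun j => (p j)^-1) m.
Proof.
move=> p0 F0 c cm; rewrite /torus_form (perm_big _ msupp_invert) big_map.
have [I [u [d [dc uE]]]] := mnm_bin_inversion b c.
(* Since (1/p)^(b - a) = p^(-b) p^a, a condition at 1/p is p^(-b) times a combination of conditions
   at p of order at most |c|. *)
transitivity ((mnm_pow p b)^-1 * \sum_i u i * torus_form F p (d i)); last first.
  by rewrite big1 ?mulr0 // => i _; rewrite F0 ?mulr0 // (leq_ltn_trans (dc i)).
rewrite /torus_form mulr_sumr.
under [RHS]eq_bigr => i _ do rewrite mulrA mulr_sumr.
rewrite exchange_big /= big_seq [RHS]big_seq; apply: eq_bigr => a /suppF ab.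
rewrite mcoeff_invert lem_subr subKm // mnm_powV uE // mulr_sumr.
apply: eq_bigr => i _.
have -> : mnm_pow p b = mnm_pow p (b - a) * mnm_pow p a by rewrite -mnm_powD submK.
field; rewrite !mnm_fact_neq0 // !mnm_pow_neq0 //.
Qed.

End Support.
End Inversion.

(** * The Cremona transformation *)

Lemma mdotX (K : fieldType) n (F : {mpoly K[n]}) a : mdot F 'X_[a] = F@_a.
Proof.
rewrite /mdot; have [aF|aF] := boolP (a \in msupp F).
  rewrite (bigD1_seq a) //= mcoeffX eqxx mulr1 big1 ?addr0 // => c ca.
  by rewrite mcoeffX eq_sym (negPf ca) mulr0.
rewrite (memN_msupp_eq0 aF) big_seq big1 // => c cF; rewrite mcoeffX.
by case: eqP aF => [->|]; rewrite ?cF ?mulr0.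
Qed.

Lemma homogz_mdeg (K : fieldType) n i (F : {mpoly K[n]}) a :
  homogz i F -> a \in msupp F -> i = Posz (mdeg a).
Proof.
case: i => [k|k] /=; last by move=> ->; rewrite msupp0.
by move=> Fk aF; rewrite -[k](dhomogP _ _ _ Fk _ aF).
Qed.

Lemma homogz_supp (K : fieldType) n i (F : {mpoly K[n]}) :
  (forall a, a \in msupp F -> i = Posz (mdeg a)) -> homogz i F.
Proof.
case: i => [k|k] Fi /=.
  by apply/dhomogP=> a /Fi[].
apply/mpolyP=> a; rewrite mcoeff0; apply: memN_msupp_eq0.
by apply/negP=> /Fi.
Qed.

Lemma linear_form_col_mx1 (K : fieldType) n s (C : 'M[K]_(s, n)) j :
  linear_form (col_mx 1%:M C) (lshift s j) = 'X_j.
Proof.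
rewrite -linear_form1; apply: eq_bigr => k _; congr (_ *: _).
by rewrite col_mxEu.
Qed.

Lemma linear_form_col_mx1_exp (K : fieldType) n s (C : 'M[K]_(s, n)) j t c :
  linear_form (col_mx 1%:M C) (lshift s j) ^+ t * 'X_[c] =
  'X_[U_(j) *+ t + c].
Proof. by rewrite linear_form_col_mx1 mpolyXn -mpolyXD. Qed.

Section Cremona.
Variables (K : fieldType) (n s : nat).
Hypothesis charK0 : [pchar K] =i pred0.
Implicit Types (C : 'M[K]_(s, n)) (e : 'I_(n + s) -> int) (F : {mpoly K[n]}).

(** At a coordinate point the generators are the monomials divisible by x_j^(e_j), and F pairs to
    zero with each of them. *)
Lemma inv_sys_supp C i e F a j :
    inv_sys (col_mx 1%:M C) i e F -> a \in msupp F ->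
  (Posz (a j) < e (lshift s j))%R.
Proof.
move=> [hF F0] aF; rewrite -ltn_truncz ltnNge; apply/negP=> ta.
have aE : (U_(j) *+ truncz (e (lshift s j)) + (a - U_(j) *+ truncz (e (lshift s
  j))))%MM = a.
  rewrite addmC submK //; apply/mnm_lepP=> k; rewrite mulmnE mnm1E.
  by case: eqP => [<-|]; rewrite ?mul1n ?mul0n.
have := F0 (lshift s j) (a - U_(j) *+ truncz (e (lshift s j)))%MM.
rewrite linear_form_col_mx1_exp aE mdotX (homogz_mdeg hF aF) -[in X in _ = X -> _]aE.
rewrite mdegD mdegMn mdeg1 mul1n addnC => /(_ erefl).
by move/eqP; rewrite mcoeff_eq0 aF.
Qed.

(** For e_j <= 0 the entry is 0 and not e_j - 1; by [inv_sys_supp] the inverse system is zero in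
    that case. *)
Definition box_corner e : 'X_{1..n} := [multinom (truncz (e (lshift s j))).-1 |
  j < n].

Section Step.
Variables (C : 'M[K]_(s, n)) (i i' : int) (e e' : 'I_(n + s) -> int).
Hypothesis C0 : forall k l, C k l != 0.
Hypothesis ii' : i + i' = \sum_(j < n) (e (lshift s j) - 1).
Hypothesis e'l : forall j, e' (lshift s j) = e (lshift s j).
Hypothesis e'r : forall k, e' (rshift n k) = e (rshift n k) + i' - i.

Lemma inv_sys_box F a : inv_sys (col_mx 1%:M C) i e F -> a \in msupp F ->
  (a <= box_corner e)%MM.
Proof.
move=> WF aF; apply/mnm_lepP=> j; rewrite mnmE.
by have := inv_sys_supp j WF aF; rewrite -ltn_truncz; case: truncz.
Qed.

Lemma inv_sys_invertK F : inv_sys (col_mx 1%:M C) i e F ->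
  invert_mpoly (box_corner e) (invert_mpoly (box_corner e) F) = F.
Proof. by move=> WF; apply: invert_mpolyK => // a; apply: inv_sys_box. Qed.

(** The box of exponents below b is stable under a -> b - a, so the coordinate points keep their
    exponents. At the other points the multiplicity is kept: i' + 1 - e'_k = i + 1 - e_k. *)
Lemma inv_sys_invert F : inv_sys (col_mx 1%:M C) i e F ->
  inv_sys (col_mx 1%:M (map_mx (@GRing.inv K) C)) i' e'
    (invert_mpoly (box_corner e) F).
Proof.
move=> WF; have [hF F0] := WF; set b := box_corner e; set G := invert_mpoly b F.
have Fb a := @inv_sys_box F a WF.
(* Only a nonzero F ensures e_j >= 1, hence b_j = e_j - 1. *)
have [F_0|] := eqVneq F 0.
  rewrite /G F_0 linear0; split; first by apply: homogz_supp => a; rewrite msupp0.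
  by move=> j a _; rewrite /mdot msupp0 big_nil.
rewrite -msupp_eq0; case Fs: (msupp F) => [//|a0 S] _.
have {S Fs} a0F : a0 \in msupp F by rewrite Fs mem_head.
have bE j : Posz (b j) = e (lshift s j) - 1.
  have := inv_sys_supp j WF a0F; rewrite mnmE.
  by case: (e _) => // -[|k] //= _; rewrite -addn1 PoszD addrK.
have i'E a : a \in msupp F -> i' = Posz (mdeg (b - a)).
  move=> aF; have iE := homogz_mdeg hF aF.
  have -> : i' = Posz (mdeg b) - i.
    rewrite mdegE (big_morph Posz PoszD (erefl _)) (eq_bigr _ (fun j _ => bE j)).
    by rewrite -ii' addrC addKr.
  by rewrite iE -{1}(submK (Fb _ aF) : (b - a + a)%MM = b) mdegD PoszD addrK.
have hG : homogz i' G.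
  apply: homogz_supp => c; rewrite (perm_mem (msupp_invert charK0 Fb)).
  by case/mapP=> a /i'E -> ->.
split=> // j; rewrite -(splitK j); case: (split j) => {j} [j|k] c /=.
  move=> _; rewrite linear_form_col_mx1_exp mdotX e'l mcoeff_invert;
    case: ifP => // /mnm_lepP/(_ j).
  rewrite mnmDE mulmnE mnm1E eqxx mul1n; have := bE j.
  by case: (e _) => [t|t] /=; lia.
move: c; have [iE i'E0] := (homogz_mdeg hF a0F, i'E _ a0F).
have Fi : F \is (mdeg a0).-homog by move: hF; rewrite iE.
have Gi : G \is (mdeg (b - a0)).-homog by move: hG; rewrite i'E0.
have Lr (M : 'M[K]_(s, n)) l : col_mx 1%:M M (rshift n k) l = M k l.
  by rewrite col_mxEd.
rewrite i'E0; apply/(linear_form_torus_cond charK0 _ Gi).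
  by move=> l; rewrite Lr mxE invr_eq0.
have -> : col_mx 1%:M (map_mx (@GRing.inv K) C) (rshift n k) =
    fun l => (col_mx 1%:M C (rshift n k) l)^-1.
  by apply/funext=> l; rewrite !Lr mxE.
apply: (torus_cond_invert charK0 Fb); first by move=> l; rewrite Lr.
rewrite e'r -i'E0 (_ : i' + 1 - _ = i + 1 - e (rshift n k)); last by ring.
rewrite iE; apply/(linear_form_torus_cond charK0 _ Fi); first by move=> l;
  rewrite Lr.
by move=> c cE; apply: F0; rewrite iE.
Qed.

End Step.

Lemma has_dim_inv_sys_invert C i i' e e' m :
    (forall k l, C k l != 0) ->
    i + i' = \sum_(j < n) (e (lshift s j) - 1) ->
    (forall j, e' (lshift s j) = e (lshift s j)) ->
    (forall k, e' (rshift n k) = e (rshift n k) + i' - i) ->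
  has_dim (inv_sys (col_mx 1%:M (map_mx (@GRing.inv K) C)) i' e') m ->
  has_dim (inv_sys (col_mx 1%:M C) i e) m.
Proof.
move=> C0 ii' e'l e'r.
have C'0 k l : map_mx (@GRing.inv K) C k l != 0 by rewrite mxE invr_eq0.
have C'K : map_mx (@GRing.inv K) (map_mx (@GRing.inv K) C) = C.
  by apply/matrixP=> k l; rewrite !mxE invrK.
have i'i : i' + i = \sum_(j < n) (e' (lshift s j) - 1).
  by rewrite addrC ii'; apply: eq_bigr => j _; rewrite e'l.
have er k : e (rshift n k) = e' (rshift n k) + i - i' by rewrite e'r; ring.
have bE : box_corner e' = box_corner e.
  by apply/mnmP=> j; rewrite !mnmE e'l.
pose T := invert_mpoly (K := K) (box_corner e).
apply: (has_dim_iso (T := T) (T' := T)) => F WF.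
- have := inv_sys_invert C'0 i'i (fun j => esym (e'l j)) er WF.
  by rewrite C'K bE.
- exact: inv_sys_invert WF.
- by have := inv_sys_invertK WF; rewrite bE.
- exact: inv_sys_invertK WF.
Qed.

End Cremona.

(** * Generic configurations *)

Section PolyFun.
Variables (K : fieldType) (r n : nat).
Implicit Types (phi psi h : 'M[K]_(r, n) -> K).

Definition polyfun phi : Prop :=
  exists p : {mpoly K[r * n]}, forall L, phi L = p.@[mxvec L 0].

Lemma polyfun_ext phi psi : phi =1 psi -> polyfun phi -> polyfun psi.
Proof. by move=> E [p pE]; exists p => L; rewrite -E. Qed.

Lemma polyfun_cst c : polyfun (fun=> c).
Proof. by exists c%:MP => L; rewrite mevalC. Qed.

Lemma polyfun_entry i j : polyfun (fun L => L i j).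
Proof. by exists 'X_(mxvec_index i j) => L; rewrite mevalXU mxvecE. Qed.

Lemma polyfunD phi psi :
  polyfun phi -> polyfun psi -> polyfun (fun L => phi L + psi L).
Proof. by move=> [p pE] [q qE]; exists (p + q) => L; rewrite mevalD pE qE. Qed.

Lemma polyfunM phi psi :
  polyfun phi -> polyfun psi -> polyfun (fun L => phi L * psi L).
Proof. by move=> [p pE] [q qE]; exists (p * q) => L; rewrite mevalM pE qE. Qed.

Lemma polyfunX phi k : polyfun phi -> polyfun (fun L => phi L ^+ k).
Proof. by move=> [p pE]; exists (p ^+ k) => L; rewrite rmorphXn /= pE. Qed.

Lemma polyfun_sum (I : Type) (s : seq I) (P : pred I) (f : I -> _ -> K) :
  (forall i, P i -> polyfun (f i)) -> polyfun (fun L => \sum_(i <- s | P i) f i L).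
Proof.
move=> fP; elim: s => [|i s IHs].
  by apply: polyfun_ext (polyfun_cst 0) => L; rewrite big_nil.
have [Pi|Pi] := boolP (P i).
  by apply: polyfun_ext (polyfunD (fP i Pi) IHs) => L; rewrite big_cons Pi.
by apply: polyfun_ext IHs => L; rewrite big_cons (negPf Pi).
Qed.

Lemma polyfun_prod (I : Type) (s : seq I) (P : pred I) (f : I -> _ -> K) :
  (forall i, P i -> polyfun (f i)) -> polyfun (fun L => \prod_(i <- s | P i) f i L).
Proof.
move=> fP; elim: s => [|i s IHs].
  by apply: polyfun_ext (polyfun_cst 1) => L; rewrite big_nil.
have [Pi|Pi] := boolP (P i).
  by apply: polyfun_ext (polyfunM (fP i Pi) IHs) => L; rewrite big_cons Pi.
by apply: polyfun_ext IHs => L; rewrite big_cons (negPf Pi).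
Qed.

Lemma polyfun_det k (M : 'M[K]_(r, n) -> 'M[K]_k) :
  (forall i j, polyfun (fun L => M L i j)) -> polyfun (fun L => \det (M L)).
Proof.
move=> MP; apply: polyfun_sum => s _; apply: polyfunM; first exact: polyfun_cst.
by apply: polyfun_prod => i _; apply: MP.
Qed.

Lemma polyfun_adj k (M : 'M[K]_(r, n) -> 'M[K]_k) i j :
  (forall i j, polyfun (fun L => M L i j)) -> polyfun (fun L => (\adj (M L)) i j).
Proof.
move=> MP; apply: (@polyfun_ext (fun L => (-1) ^+ (j + i) * \det (row' j (col'
  i (M L))))).
  by move=> L; rewrite mxE.
apply: polyfunM; first exact: polyfun_cst.
apply: polyfun_det => k1 k2; apply: polyfun_ext (MP (lift j k1) (lift i k2)) => L.
by rewrite !mxE.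
Qed.

(** A nonempty principal open set is enough for existence of a Zariski open set, and is easy to
    intersect and to pull back. *)
Definition generic (P : 'M[K]_(r, n) -> Prop) : Prop :=
  exists phi, [/\ polyfun phi, exists L, phi L != 0 & forall L, phi L != 0 -> P L].

Lemma generic_sub (P Q : 'M[K]_(r, n) -> Prop) :
  (forall L, P L -> Q L) -> generic P -> generic Q.
Proof. by move=> PQ [phi [pphi ex phiP]]; exists phi; split=> // L /phiP/PQ. Qed.

Lemma genericT (P : 'M[K]_(r, n) -> Prop) : (forall L, P L) -> generic P.
Proof.
move=> PT; exists (fun=> 1); split=> //; first exact: polyfun_cst.
by exists 0; apply: oner_neq0.
Qed.

Lemma generic_zariski P : generic P ->
  exists U : 'M[K]_(r, n) -> Prop,
    [/\ zariski_open U, exists L, U L & forall L, U L -> P L].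
Proof.
case=> phi [[p pE] ex phiP]; exists (fun L => phi L != 0); split=> //.
exists (fun q => q = p) => L; rewrite pE; split=> [pL|[q -> //]].
by exists p.
Qed.

Lemma polyfun_line phi L0 L1 : polyfun phi ->
  exists q : {poly K}, forall t, q.[t] = phi (L0 + t *: (L1 - L0)).
Proof.
case=> p pE; pose l (k : 'I_(r * n)) : {poly K} :=
  (mxvec L0 0 k)%:P + (mxvec (L1 - L0) 0 k) *: 'X.
exists (mmap polyC l p) => t; rewrite pE mevalE /mmap horner_sum.
apply: eq_bigr => a _; rewrite hornerM hornerC; congr (_ * _).
rewrite /mmap1 horner_prod; apply: eq_bigr => k _.
rewrite horner_exp hornerD hornerC hornerZ hornerX.
have -> : mxvec (L0 + t *: (L1 - L0)) = mxvec L0 + t *: mxvec (L1 - L0).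
  by rewrite linearD linearZ.
by rewrite !mxE [t * _]mulrC.
Qed.

End PolyFun.

(** In characteristic zero the first [size q] natural numbers are distinct in K, one more than the
    number of possible roots. *)
Lemma poly_nonroot (K : fieldType) (q : {poly K}) :
  [pchar K] =i pred0 -> q != 0 -> exists t, q.[t] != 0.
Proof.
move=> charK0 q0; apply: contrapT => nex.
have rootq t : root q t by apply/negPn/negP=> qt; apply: nex; exists t.
have := max_poly_roots q0 (rs := [seq k%:R | k <- iota 0 (size q)]).
rewrite size_map size_iota ltnn (map_inj_uniq (natr_inj_pchar0 charK0)) iota_uniq.
by move=> /(_ _ isT) H; have := H _; rewrite (introT allP) // => /(_ isT).
Qed.

Section Generic.
Variable K : fieldType.
Hypothesis charK0 : [pchar K] =i pred0.

(** On the line joining a point of each open set neither polynomial vanishes identically, so neither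
    does their product. *)
Lemma generic_and r n (P Q : 'M[K]_(r, n) -> Prop) :
  generic P -> generic Q -> generic (fun L => P L /\ Q L).
Proof.
move=> [phi [pphi [L0 phi0] phiP]] [psi [ppsi [L1 psi1] psiQ]].
exists (fun L => phi L * psi L); split; first exact: polyfunM; last first.
  by move=> L; rewrite mulf_eq0 negb_or => /andP[/phiP ? /psiQ].
have [p pE] := polyfun_line L0 L1 pphi; have [q qE] := polyfun_line L0 L1 ppsi.
have : p * q != 0.
  rewrite mulf_neq0 //.
    by apply: contraNneq phi0 => p0; have := pE 0;
      rewrite p0 horner0 scale0r addr0 => <-.
  apply: contraNneq psi1 => q0.
  by have := qE 1; rewrite q0 horner0 scale1r addrC subrK => <-.
case/(poly_nonroot charK0) => t; rewrite hornerM pE qE => pqt.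
by exists (L0 + t *: (L1 - L0)).
Qed.

(* [h] is a denominator of the rational self-map [T]. *)
Lemma generic_pullback r n (T : 'M[K]_(r, n) -> 'M[K]_(r, n)) h
    (P : 'M[K]_(r, n) -> Prop) :
    polyfun h -> (exists L, h L != 0) ->
    (forall i j, exists2 psi, polyfun psi &
       forall L, h L != 0 -> psi L = h L * T L i j) ->
    (forall L, h L != 0 -> exists2 L', h L' != 0 & T L' = L) ->
  generic P -> generic (fun L => h L != 0 /\ P (T L)).
Proof.
move=> ph exh hT surjT genP.
(* [D phi] says that [phi] composed with [T] becomes polynomial after multiplication by a power of
   [h]. This class contains the coordinates and is closed under sums and products, so it contains
   all polynomial functions. *)
pose D (phi : 'M[K]_(r, n) -> K) := exists k psi, polyfun psi /\
  forall L, h L != 0 -> psi L = h L ^+ k * phi (T L).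
have Dext phi psi : phi =1 psi -> D phi -> D psi.
  by move=> E [k [f [pf fE]]]; exists k, f; split=> // L /fE ->; rewrite E.
have D0 c : D (fun=> c).
  exists 0%N, (fun=> c); split; first exact: polyfun_cst.
  by move=> L _; rewrite mul1r.
have DD phi psi : D phi -> D psi -> D (fun L => phi L + psi L).
  move=> [k [f [pf fE]]] [l [g [pg gE]]].
  exists (k + l)%N, (fun L => h L ^+ l * f L + h L ^+ k * g L); split.
    by apply: polyfunD; apply: polyfunM => //; apply: polyfunX.
  by move=> L hL; rewrite fE // gE // exprD; ring.
have DM phi psi : D phi -> D psi -> D (fun L => phi L * psi L).
  move=> [k [f [pf fE]]] [l [g [pg gE]]].
  exists (k + l)%N, (fun L => f L * g L); split; first exact: polyfunM.
  by move=> L hL; rewrite fE // gE // exprD; ring.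
have Dp phi : polyfun phi -> D phi.
  case=> p pE; apply: (Dext (fun L => \sum_(a <- msupp p)
      p@_a * \prod_k mxvec L 0 k ^+ a k)).
    by move=> L; rewrite pE mevalE.
  elim: (msupp p) => [|a S IHS].
    by apply: Dext (D0 0) => L; rewrite big_nil.
  apply: (Dext (fun L => p@_a * \prod_k mxvec L 0 k ^+ a k +
      \sum_(a <- S) p@_a * \prod_k mxvec L 0 k ^+ a k)).
    by move=> L; rewrite big_cons.
  apply: DD => //; apply: (DM _ _) => //.
  elim: (index_enum _) => [|k s IHs].
    by apply: Dext (D0 1) => L; rewrite big_nil.
  apply: (Dext (fun L => mxvec L 0 k ^+ a k * \prod_(j <- s) mxvec L 0 j ^+ a j)).
    by move=> L; rewrite big_cons.
  apply: (DM _ _) => //; elim: (a k) => [|m IHm]; first exact: D0.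
  apply: (Dext (fun L => mxvec L 0 k * mxvec L 0 k ^+ m)) => [L|].
    by rewrite exprS.
  apply: (DM _ _) => //; case/mxvec_indexP: k {IHm} => i j.
  have [f pf fE] := hT i j; exists 1%N, f; split=> // L /fE ->.
  by rewrite mxvecE.
have genh : generic (fun L => h L != 0) by exists h; split.
case: genP => phi [pphi exphi phiP].
have genphi : generic (fun L => phi L != 0) by exists phi.
(* A point where neither [phi] nor [h] vanishes; its preimage under [T] shows that the pulled-back
   polynomial is nonzero. *)
have [f [_ [L1 /[swap] /[apply] [[phi1 h1]]]]] := generic_and genphi genh.
have [L2 h2 TL2] := surjT _ h1.
have [k [psi [ppsi psiE]]] := Dp _ pphi.
exists (fun L => psi L * h L); split; first exact: polyfunM.
  by exists L2; rewrite psiE // TL2 !mulf_neq0 // expf_neq0.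
move=> L; rewrite mulf_eq0 negb_or => /andP[psi0 hL]; split=> //.
by apply: phiP; apply: contraNneq psi0 => phi0; rewrite psiE // phi0 mulr0.
Qed.

Lemma generic_row_perm r n (s : 'S_r) i (e : 'I_r -> int) m :
  generic (fun L : 'M[K]_(r, n) => has_dim (inv_sys L i (e \o s)) m) ->
  generic (fun L : 'M[K]_(r, n) => has_dim (inv_sys L i e) m).
Proof.
move=> gen; apply: generic_sub (generic_pullback (T := row_perm s) (h := fun=>
  1) _ _ _ _ gen).
- move=> L [_].
  have lf j : linear_form (row_perm s L) j = linear_form L (s j).
    by apply: eq_bigr => l _; rewrite mxE.
  apply: has_dim_ext => F; split=> -[hF F0]; split=> // j a.
    by have := F0 (s^-1 j)%g a; rewrite lf /= permKV.
  by move=> aE; rewrite lf; apply: F0.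
- exact: polyfun_cst.
- by exists 0; apply: oner_neq0.
- move=> k l; exists (fun L => L (s k) l); first exact: polyfun_entry.
  by move=> L _; rewrite mxE mul1r.
- move=> L _; exists (row_perm s^-1%g L); first exact: oner_neq0.
  by apply/matrixP=> k l; rewrite !mxE permK.
Qed.

(** * The Cremona map on configurations of points *)

Section CremonaMap.
Variables n s : nat.
Implicit Type L : 'M[K]_(n + s, n).

(** Nonzero exactly when the first n points form a basis in which the others have no zero
    coordinate; the adjugate replaces the inverse to stay polynomial. *)
Definition cremona_den L : K :=
  \det (usubmx L) * \prod_k \prod_l (dsubmx L *m \adj (usubmx L)) k l.

(** Inverts the coordinates of the last s points in the basis of the first n, then returns to the
    original coordinates, which makes the map an involution. *)
Definition cremona_mx L : 'M[K]_(n + s, n) :=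
  col_mx (usubmx L)
    (map_mx (@GRing.inv K) (dsubmx L *m invmx (usubmx L)) *m usubmx L).

Lemma cremona_denP L : cremona_den L != 0 <->
  usubmx L \in unitmx /\ forall k l, (dsubmx L *m invmx (usubmx L)) k l != 0.
Proof.
rewrite /cremona_den mulf_eq0 negb_or unitmxE unitfE.
split=> [/andP[detA /prodf_neq0 B0]|[detA B0]].
  split=> // k l; rewrite /invmx unitmxE unitfE detA -scalemxAr mxE.
  by rewrite mulf_neq0 ?invr_eq0 //; have /prodf_neq0 := B0 k isT; apply.
rewrite detA; apply/prodf_neq0 => k _; apply/prodf_neq0 => l _.
have := B0 k l; rewrite /invmx unitmxE unitfE detA -scalemxAr mxE mulf_eq0.
by rewrite negb_or => /andP[].
Qed.

Lemma cremona_factor L : usubmx L \in unitmx ->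
  col_mx 1%:M (dsubmx L *m invmx (usubmx L)) *m usubmx L = L.
Proof. by move=> Au; rewrite mul_col_mx mul1mx mulmxKV // vsubmxK. Qed.

Lemma cremona_mxK L : cremona_den L != 0 ->
  cremona_den (cremona_mx L) != 0 /\ cremona_mx (cremona_mx L) = L.
Proof.
move=> /cremona_denP[Au C0]; have E := cremona_factor Au; split.
  apply/cremona_denP; rewrite /cremona_mx col_mxKu col_mxKd mulmxK //.
  by split=> // k l; rewrite mxE invr_eq0.
rewrite {1}/cremona_mx {1 2 3}/cremona_mx !col_mxKu col_mxKd mulmxK //.
rewrite (_ : map_mx _ (map_mx _ _) = dsubmx L *m invmx (usubmx L)).
  by rewrite mulmxKV // vsubmxK.
by apply/matrixP=> k l; rewrite !mxE invrK.
Qed.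

Lemma polyfun_cremona_num k l :
  polyfun (fun L => (dsubmx L *m \adj (usubmx L)) k l).
Proof.
apply: (@polyfun_ext _ _ _ (fun L => \sum_j L (rshift n k) j * (\adj (usubmx
  L)) j l)).
  by move=> L; rewrite mxE; apply: eq_bigr => j _; rewrite [dsubmx L k j]mxE.
apply: polyfun_sum => j _; apply: polyfunM; first exact: polyfun_entry.
apply: polyfun_adj => i1 i2;
  apply: polyfun_ext (polyfun_entry _ (lshift s i1) i2) => L.
by rewrite mxE.
Qed.

Lemma polyfun_det_usubmx : polyfun (fun L => \det (usubmx L)).
Proof.
apply: polyfun_det => i1 i2;
  apply: polyfun_ext (polyfun_entry _ (lshift s i1) i2) => L.
by rewrite mxE.
Qed.

Lemma polyfun_cremona_den : polyfun cremona_den.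
Proof.
apply: polyfunM; first exact: polyfun_det_usubmx.
by apply: polyfun_prod => k _; apply: polyfun_prod => l _;
  apply: polyfun_cremona_num.
Qed.

Lemma cremona_den_nonzero : exists L, cremona_den L != 0.
Proof.
exists (col_mx 1%:M (const_mx 1)); apply/cremona_denP.
rewrite col_mxKu col_mxKd unitmx1 invmx1 mulmx1; split=> // k l.
by rewrite mxE oner_neq0.
Qed.

Lemma cremona_mx_rational i j : exists2 psi, polyfun psi &
  forall L, cremona_den L != 0 -> psi L = cremona_den L * cremona_mx L i j.
Proof.
rewrite -(splitK i); case: (split i) => {i} [i|k] /=.
  exists (fun L => cremona_den L * L (lshift s i) j).
    by apply: polyfunM; [apply: polyfun_cremona_den|apply: polyfun_entry].
  by move=> L _; rewrite col_mxEu mxE.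
(* With N the product by the adjugate, each inverted coordinate is det / N_kl. Multiplying by
   [cremona_den] cancels N_kl and leaves det^2 times the other entries of N. *)
exists (fun L => \sum_l (\det (usubmx L) * \det (usubmx L) *
  (\prod_(l' | l' != l) (dsubmx L *m \adj (usubmx L)) k l') *
  (\prod_(k' | k' != k) \prod_l' (dsubmx L *m \adj (usubmx L)) k' l')) *
  L (lshift s l) j).
  apply: polyfun_sum => l _; apply: polyfunM; last exact: polyfun_entry.
  apply: polyfunM.
    apply: polyfunM; first by apply: polyfunM; apply: polyfun_det_usubmx.
    by apply: polyfun_prod => l' _; apply: polyfun_cremona_num.
  by apply: polyfun_prod => k' _; apply: polyfun_prod => l' _;
    apply: polyfun_cremona_num.
move=> L hL /=; have /cremona_denP[Au C0] := hL.
have -> : cremona_mx L (rshift n k) j =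
    \sum_l ((dsubmx L *m invmx (usubmx L)) k l)^-1 * L (lshift s l) j.
  rewrite col_mxEd mxE; apply: eq_bigr => l _.
  by rewrite [usubmx L l j]mxE; congr (_ * _); rewrite mxE.
rewrite [RHS]mulr_sumr; apply: eq_bigr => l _; rewrite mulrA; congr (_ * _).
have invE : (dsubmx L *m invmx (usubmx L)) k l =
    (\det (usubmx L))^-1 * (dsubmx L *m \adj (usubmx L)) k l.
  by rewrite /invmx Au -scalemxAr [LHS]mxE.
have detA : \det (usubmx L) != 0 by rewrite -unitfE -unitmxE.
have := C0 k l; rewrite invE mulf_eq0 negb_or => /andP[_ N0].
set P2 := \prod_(k' | k' != k) _; set P1 := \prod_(l' | l' != l) _.
have -> : cremona_den L =
    \det (usubmx L) * ((dsubmx L *m \adj (usubmx L)) k l * P1 * P2).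
  by congr (_ * _); rewrite (bigD1 k) //=; congr (_ * _); rewrite (bigD1 l).
by field; rewrite ?N0 ?detA.
Qed.

(** Up to coordinate changes, [L] and [cremona_mx L] are the identity stacked on C and on its
    entrywise inverse; inversion of exponents compares these. *)
Lemma generic_cremona i i' (e e' : 'I_(n + s) -> int) m :
    i + i' = \sum_(j < n) (e (lshift s j) - 1) ->
    (forall j, e' (lshift s j) = e (lshift s j)) ->
    (forall k, e' (rshift n k) = e (rshift n k) + i' - i) ->
  generic (fun L : 'M[K]_(n + s, n) => has_dim (inv_sys L i' e') m) ->
  generic (fun L : 'M[K]_(n + s, n) => has_dim (inv_sys L i e) m).
Proof.
move=> ii' e'l e'r gen.
apply: generic_sub (generic_pullback polyfun_cremona_den cremona_den_nonzero
  cremona_mx_rational _ gen) => L; last first.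
  by move/cremona_mxK => [hL LK]; exists (cremona_mx L).
case=> /cremona_denP[Au C0] dimT; rewrite -(cremona_factor Au).
apply: (has_dim_inv_sys_mulmx Au);
  apply: (has_dim_inv_sys_invert charK0 C0 ii' e'l e'r).
have Au' : invmx (usubmx L) \in unitmx by rewrite unitmx_inv.
have cremonaE : cremona_mx L *m invmx (usubmx L) =
    col_mx 1%:M (map_mx (@GRing.inv K) (dsubmx L *m invmx (usubmx L))).
  by rewrite mul_col_mx (mulmxV Au) (mulmxK Au).
by rewrite -cremonaE; apply: has_dim_inv_sys_mulmx.
Qed.

End CremonaMap.
End Generic.

(** * Unisolvent sets of lattice points *)

Section Unisolvent.
Variables (K : fieldType) (V : Type).
Implicit Types (l : V -> K) (ls : seq (V -> K)) (S : V -> Prop).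

(* [n] is a strict bound on the total degree. *)
Inductive pdeg ls : nat -> (V -> K) -> Prop :=
| pdeg0 n : pdeg ls n (fun=> 0)
| pdegC n c : pdeg ls n.+1 (fun=> c)
| pdegD n f g : pdeg ls n f -> pdeg ls n g -> pdeg ls n (fun v => f v + g v)
| pdegM n l f : List.In l ls -> pdeg ls n f -> pdeg ls n.+1 (fun v => l v * f v).

Lemma pdeg_ext ls n f g : f =1 g -> pdeg ls n f -> pdeg ls n g.
Proof. by move=> /funext ->. Qed.

Lemma pdeg_eq0 ls f v : pdeg ls 0 f -> f v = 0.
Proof.
move E: 0%N => n fP; elim: fP E => {n f} // n f g _ IHf _ IHg n0.
by rewrite IHf // IHg // addr0.
Qed.

Lemma pdegS ls n f : pdeg ls n f -> pdeg ls n.+1 f.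
Proof.
elim=> {n f} *; [exact: pdeg0|exact: pdegC|exact: pdegD|exact: pdegM].
Qed.

Lemma pdeg_cons l ls n f : pdeg ls n f -> pdeg (l :: ls) n f.
Proof.
elim=> {n f} [n|n c|n f g _ ? _ ?|n l' f ? _ ?];
  [exact: pdeg0|exact: pdegC|exact: pdegD|].
by apply: pdegM => //; right.
Qed.

Lemma pdegZ ls n c f : pdeg ls n f -> pdeg ls n (fun v => c * f v).
Proof.
elim=> {n f} [n|n c'|n f g _ IHf _ IHg|n l' f l'P _ IHf].
- by apply: pdeg_ext (pdeg0 _ _) => v; rewrite mulr0.
- exact: pdegC.
- by apply: pdeg_ext (pdegD IHf IHg) => v; rewrite mulrDr.
- by apply: pdeg_ext (pdegM l'P IHf) => v; rewrite mulrCA.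
Qed.

(** Division by l - c: the remainder no longer involves l, and the quotient has degree one less. *)
Lemma pdeg_divided_difference l ls c n f : pdeg (l :: ls) n f ->
  exists g f', [/\ pdeg ls n g, pdeg (l :: ls) n.-1 f' &
                   forall v, f v = g v + (l v - c) * f' v].
Proof.
elim=> {n f} [n|n c0|n f1 f2 _ [g1 [h1 [? ? E1]]] _ [g2 [h2 [? ? E2]]]|n l0 f
  l0P fP].
- exists (fun=> 0), (fun=> 0); split; try exact: pdeg0.
  by move=> v; rewrite mulr0 addr0.
- exists (fun=> c0), (fun=> 0); split; [exact: pdegC|exact: pdeg0|].
  by move=> v; rewrite mulr0 addr0.
- exists (fun v => g1 v + g2 v), (fun v => h1 v + h2 v).
  by split; [exact: pdegD|exact: pdegD|move=> v; rewrite E1 E2; ring].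
case=> g [h [gP hP E]]; case: n => [|n] in fP gP hP *.
  exists (fun=> 0), (fun=> 0); split; try exact: pdeg0.
  by move=> v; rewrite (pdeg_eq0 v fP) !mulr0 addr0.
case: l0P => [<-|l0P].
  exists (fun v => c * g v), (fun v => g v + l v * h v); split.
  - exact/pdegZ/pdegS.
  - by apply: pdegD; [apply: pdeg_cons|apply: pdegM => //; left].
  - by move=> v; rewrite E; ring.
exists (fun v => l0 v * g v), (fun v => l0 v * h v); split.
- exact: pdegM.
- by apply: pdegM => //; right.
- by move=> v; rewrite E; ring.
Qed.

Definition unisolvent ls n S : Prop :=
  forall f, pdeg ls n f -> (forall v, S v -> f v = 0) -> forall v, f v = 0.

Lemma unisolvent_nil n S v0 : S v0 -> unisolvent [::] n S.
Proof.
move=> Sv0 f fP /(_ _ Sv0) + v => <-.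
elim: fP => {f} // m f g _ IHf _ IHg; first by rewrite IHf IHg.
Qed.

(* Newton interpolation: peel off the hyperplanes [l = c j] one at a time, the
   degree dropping by one each time. *)
Lemma unisolvent_cons l ls n S (c : nat -> K) :
    (forall j k, (j < k < n)%N -> c j != c k) ->
    (forall j, (j < n)%N -> unisolvent ls (n - j) (fun v => S v /\ l v = c j)) ->
  unisolvent (l :: ls) n S.
Proof.
elim: n S c => [|n IHn] S c c_inj cS f fP f0 v; first exact: pdeg_eq0 fP.
have [g [f' [gP f'P fE]]] := pdeg_divided_difference (c 0%N) fP.
(* [g] does not involve [l] and agrees with [f] on the slice where [l] equals [c 0], so unisolvence
   of the slice applies. *)
have g0 : forall w, g w = 0.
  apply: (cS 0%N) => // w [Sw lw].
  by rewrite -(f0 w Sw) fE lw subrr mul0r addr0.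
rewrite fE g0 add0r.
have -> : f' v = 0; last by rewrite mulr0.
apply: (IHn (fun w => S w /\ l w != c 0%N) (fun j => c j.+1) _ _ f') => //.
- by move=> j k /andP[jk kn]; apply: c_inj; rewrite !ltnS jk.
- move=> j jn h hP h0; apply: (cS j.+1) => // w [Sw lw].
  by apply: h0; split=> //; split=> //; rewrite lw eq_sym c_inj.
- move=> w [Sw lw]; have := f0 w Sw; rewrite fE g0 add0r => /eqP.
  by rewrite mulf_eq0 subr_eq0 (negPf lw) => /eqP.
Qed.

End Unisolvent.

(** * Interpolation on lattice points of prescribed parity *)

Section ParityGrid.
Variables (K : fieldType) (V : Type).
Hypothesis charK0 : [pchar K] =i pred0.
Variables x y z : V -> nat.
Implicit Type S : V -> Prop.

(* The [j]-th value of parity [s], moving away from the middle of [0, 2n). *)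
Definition parity_node (s : bool) n j : nat :=
  if odd (n + j) == s then (n + j)%N else (n.-1 - j)%N.

Lemma parity_node_odd s n j : (j < n)%N -> odd (parity_node s n j) = s.
Proof.
move=> jn; rewrite /parity_node; case: eqP => // ns.
have : odd (n + j) = ~~ odd (n.-1 - j) by lia.
by case: (odd (n + j)) ns; case: s; case: odd.
Qed.

Lemma parity_node_neq s n j k : (j < k < n)%N ->
  (parity_node s n j)%:R != (parity_node s n k)%:R :> K.
Proof.
move=> /andP[jk kn]; rewrite (inj_eq (natr_inj_pchar0 charK0)) /parity_node.
by apply/eqP; do 2!case: ifP => _; lia.
Qed.

Let X v : K := (x v)%:R.
Let U v : K := (x v + y v)%:R.
Let W v : K := (x v + z v)%:R.

(** The diagonals x + z = const of the right parity are taken outwards from the middle: the j-th has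
    n - j points in the rectangle, as many as degree less than n - j requires. *)
Lemma unisolvent_parity_rectangle n x0 t S :
    (forall a b, (a < n)%N -> (b <= n)%N -> odd (x0 + a + b) = t ->
       exists v, [/\ S v, x v = (x0 + a)%N & z v = b]) ->
  unisolvent [:: W; X] n S.
Proof.
move=> SP; pose tau := t (+) odd x0.
apply: (@unisolvent_cons _ _ _ _ _ _ (fun j => (x0 + parity_node tau n j)%:R)).
  move=> j k jk; rewrite !natrD (inj_eq (addrI _)); exact: parity_node_neq.
move=> j jn; pose a0 := if odd (n + j) == tau then j else 0%N.
apply: (@unisolvent_cons _ _ _ _ _ _ (fun l => (x0 + a0 + l)%:R)).
  by move=> l k lk; rewrite (inj_eq (natr_inj_pchar0 charK0)); apply/eqP; lia.
move=> l lnj.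
have nodeO := parity_node_odd tau jn.
have [v [Sv xv zv]] : exists v, [/\ S v, x v = (x0 + (a0 + l))%N &
    z v = (parity_node tau n j - (a0 + l))%N].
  have le : (a0 + l <= parity_node tau n j)%N.
    by rewrite /a0 /parity_node; case: ifP => _; lia.
  apply: SP.
  - by rewrite /a0; case: ifP => _; lia.
  - by rewrite /a0 /parity_node; case: ifP => _; lia.
  - by rewrite -addnA subnKC // oddD nodeO /tau addbC addbK.
apply: (@unisolvent_nil _ _ _ _ v); split.
  split=> //; rewrite /W xv zv; congr _%:R.
  by move: zv xv; rewrite /a0 /parity_node; case: ifP => _; lia.
by rewrite /X xv addnA.
Qed.

(** The slice x + y = [parity_node s m j] contains a parity rectangle of size m - j. On it x + y + z
    <= (m + j) + (m - j), whence the bound 2m. *)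
Lemma unisolvent_parity_grid m s t S :
    (forall a b c, (a <= m)%N -> (b <= m)%N -> (c <= m)%N ->
       (a + b + c <= m.*2)%N -> odd (a + b) = s -> odd (a + c) = t ->
       exists v, [/\ S v, x v = a, y v = b & z v = c]) ->
  unisolvent [:: U; W; X] m S.
Proof.
move=> SP; apply: (@unisolvent_cons _ _ _ _ _ _ (fun j => (parity_node s m j)%:R)).
  exact: parity_node_neq.
move=> j jm; pose x0 := if odd (m + j) == s then j else 0%N.
apply: (@unisolvent_parity_rectangle _ x0 t) => a c am cm tE.
have nodeO := parity_node_odd s jm.
have le : (x0 + a <= parity_node s m j)%N.
  by rewrite /x0 /parity_node; case: ifP => _; lia.
have [v [Sv xv yv zv]] : exists v, [/\ S v, x v = (x0 + a)%N,
    y v = (parity_node s m j - (x0 + a))%N & z v = c].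
  apply: SP => //.
  - by rewrite /x0; case: ifP => _; lia.
  - by rewrite /x0 /parity_node; case: ifP => _; lia.
  - lia.
  - by rewrite subnKC // /parity_node; case: ifP => _; lia.
  - by rewrite subnKC.
exists v; split=> //; split=> //.
by rewrite /U xv yv subnKC.
Qed.

End ParityGrid.

(** Induction by (g + 1) binom(q, g + 1) = (q - g) binom(q, g). *)
Lemma pdeg_bin (K : fieldType) (charK0 : [pchar K] =i pred0) V
    (ls : seq (V -> K)) (q : V -> nat) n g f :
    (forall n f, pdeg ls n f -> pdeg ls n.+1 (fun v => (q v)%:R * f v)) ->
  pdeg ls n f -> pdeg ls (g + n) (fun v => 'C(q v, g)%:R * f v).
Proof.
move=> qP fP; elim: g => [|g IHg].
  by apply: pdeg_ext fP => v; rewrite bin0 mul1r.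
have g0 := natr_pchar0_neq0 charK0 (ltn0Sn g).
have := pdegD (pdegZ g.+1%:R^-1 (qP _ _ IHg)) (pdegZ (- (g%:R / g.+1%:R))
  (pdegS IHg)).
apply: pdeg_ext => v; have := bin_mul (q v) g.
move/(congr1 (fun k => k%:R : K)); rewrite natrD !natrM => E.
by rewrite [(q v)%:R * _]mulrA E; move: (g.+1)%:R g0 => d d0; field.
Qed.

Local Notation o k := (@Ordinal 4 k isT).

Lemma big_ord4 (R : Type) (idx : R) op (F : 'I_4 -> R) :
  \big[op/idx]_(k < 4) F k = op (F (o 0)) (op (F (o 1)) (op (F (o 2)) (op (F (o
    3)) idx))).
Proof.
rewrite !big_ord_recl big_ord0.
by congr (op (F _) (op (F _) (op (F _) (op (F _) _)))); apply/val_inj.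
Qed.

(** * Independence within one parity class of monomials *)

Section FourVariables.

Variables (K : fieldType) (charK0 : [pchar K] =i pred0).

(** The sum is a polynomial of degree less than m in the exponent [a], so vanishing on a parity grid
    makes it zero on the whole simplex |a| = i; triangularity of binom(a, c) then gives u = 0. *)
Lemma class_independent (m i : nat) (s t : bool) (u : 'X_{1..4} -> K) :
    (0 < m)%N -> (m.*2 <= i)%N ->
    (forall a, mdeg a = i -> (forall j : 'I_4, (j < 3)%N -> (a j <= m)%N) ->
       odd (a (o 0) + a (o 1))%N = s -> odd (a (o 0) + a (o 2))%N = t ->
       \sum_(c <- mons 4 m.-1) u c * (mnm_bin a c)%:R = 0) ->
  forall c, mdeg c = m.-1 -> u c = 0.
Proof.
move=> m0 mi u0.
pose V := {a : 'X_{1..4} | mdeg a == i}.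
pose x (v : V) := val v (o 0); pose y (v : V) := val v (o 1).
pose z (v : V) := val v (o 2); pose w (v : V) := val v (o 3).
have degE (v : V) : (x v + y v + z v + w v)%N = i.
  by have /eqP <- := valP v; rewrite mdegE big_ord4 addn0 !addnA.
pose X v : K := (x v)%:R; pose U v : K := (x v + y v)%:R.
pose W v : K := (x v + z v)%:R; pose ls := [:: U; W; X].
have Xm n f : pdeg ls n f -> pdeg ls n.+1 (fun v => X v * f v).
  by apply: pdegM; do 2 right; left.
have Um n f : pdeg ls n f -> pdeg ls n.+1 (fun v => U v * f v).
  by apply: pdegM; left.
have Wm n f : pdeg ls n f -> pdeg ls n.+1 (fun v => W v * f v).
  by apply: pdegM; right; left.
have Ym n f : pdeg ls n f -> pdeg ls n.+1 (fun v => (y v)%:R * f v).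
  move=> fP; apply: pdeg_ext (pdegD (Um _ _ fP) (pdegZ (-1) (Xm _ _ fP))) => v.
  by rewrite /U /X natrD; ring.
have Zm n f : pdeg ls n f -> pdeg ls n.+1 (fun v => (z v)%:R * f v).
  move=> fP; apply: pdeg_ext (pdegD (Wm _ _ fP) (pdegZ (-1) (Xm _ _ fP))) => v.
  by rewrite /W /X natrD; ring.
(* The fourth exponent is i - (x + y) - z on the simplex, hence still of degree one. *)
have Tm n f : pdeg ls n f -> pdeg ls n.+1 (fun v => (w v)%:R * f v).
  move=> fP.
  have := pdegD (pdegD (pdegZ i%:R (pdegS fP)) (pdegZ (-1) (Um _ _ fP)))
                (pdegZ (-1) (Zm _ _ fP)).
  by apply: pdeg_ext => v; rewrite /U -(degE v) !natrD; ring.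
have binP c : pdeg ls (mdeg c).+1 (fun v => (mnm_bin (val v) c)%:R).
  have := pdeg_bin charK0 (c (o 0)) Xm (pdeg_bin charK0 (c (o 1)) Ym
    (pdeg_bin charK0 (c (o 2)) Zm (pdeg_bin charK0 (c (o 3)) Tm (pdegC ls 0 1)))).
  have -> : (c (o 0) + (c (o 1) + (c (o 2) + (c (o 3) + 1))) = (mdeg c).+1)%N.
    by rewrite mdegE big_ord4 !addnA addn0 addn1.
  by apply: pdeg_ext => v; rewrite /mnm_bin big_ord4 !natrM.
have {u0} all0 a : mdeg a = i -> \sum_(c <- mons 4 m.-1) u c * (mnm_bin a c)%:R = 0.
  move=> /eqP ai; pose v : V := exist _ a ai.
  pose f (v : V) := \sum_(c <- mons 4 m.-1) u c * (mnm_bin (val v) c)%:R.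
  pose S (v : V) := [/\ (x v <= m)%N, (y v <= m)%N, (z v <= m)%N,
    odd (x v + y v) = s & odd (x v + z v) = t].
  have unis : unisolvent ls m S.
    apply: (unisolvent_parity_grid charK0 (s := s) (t := t)) => a0 a1 a2 h0 h1
      h2 h012 hs ht.
    (* The fourth exponent absorbs the remaining degree, nonnegative because a0 + a1 + a2 <= 2m <=
       i. *)
    pose b : 'X_{1..4} := [multinom nth 0%N [:: a0; a1; a2;
      (i - (a0 + a1 + a2))%N] j | j < 4].
    have bi : mdeg b == i.
      rewrite mdegE big_ord4 !mnmE /= addn0 !addnA; apply/eqP.
      by rewrite subnKC // (leq_trans h012).
    exists (exist _ b bi); rewrite /S /x /y /z /= !mnmE /=.
    by do !split.
  apply: (unis f _ _ v).
    rewrite /f; have : all (fun c => mdeg c == m.-1) (mons 4 m.-1).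
      by apply/allP=> c; rewrite mem_mons.
    elim: (mons 4 m.-1) => [_|c r IHr /= /andP[/eqP cm /IHr rP]].
      by apply: pdeg_ext (pdeg0 _ _) => v'; rewrite big_nil.
    have := pdegD (pdegZ (u c) (binP c)) (_ : pdeg ls (mdeg c).+1 _).
    rewrite cm (prednK m0) => /(_ _ rP); apply: pdeg_ext => v'.
    by rewrite big_cons.
  move=> v' [h0 h1 h2 hs ht]; apply: u0 => //; first exact/eqP/(valP v').
  by case=> [[|[|[|]]]] // jlt _; [move: h0|move: h1|move: h2]; rewrite /x /y /z;
    congr (val v' _ <= m)%N; apply/val_inj.
pose h (c : 'X_{1..4}) := (c (o 0) + c (o 1) + c (o 2))%N.
have degh (c : 'X_{1..4}) : mdeg c = (h c + c (o 3))%N.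
  by rewrite mdegE big_ord4 !addnA addn0.
have mi' : (m.-1 <= i)%N by lia.
move=> c; have [k] := ubnP (h c); elim: k c => // k IHk c; rewrite ltnS => hk cm.
(* The missing degree goes to the last variable. Any other c' <= a of the degree of [c] then has a
   smaller [h], so its coefficient is already zero. *)
pose a := (c + U_(o 3) *+ (i - m.-1))%MM.
have aE j : a j = (c j + (o 3 == j) * (i - m.-1))%N by rewrite mnmDE mulmnE mnm1E.
have ai : mdeg a = i by rewrite mdegD mdegMn mdeg1 mul1n cm subnKC.
have := all0 a ai; rewrite (bigD1_seq c) ?mons_uniq //=; last by rewrite mem_mons cm.
rewrite big_seq_cond big1 ?addr0 => [/eqP|c' /andP[]].
  rewrite mulf_eq0 => /orP[/eqP //|]; rewrite -[_ == 0]negbK natr_pchar0_neq0 //.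
  by apply: prodn_gt0 => j; rewrite bin_gt0 aE leq_addr.
rewrite mem_mons => /eqP c'm c'c.
have [c'a|/mnm_bin_small ->] := boolP (c' <= a)%MM; last by rewrite mulr0.
have le (j : 'I_4) : (j < 3)%N -> (c' j <= c j)%N.
  move=> j3; have /mnm_lepP/(_ j) := c'a; rewrite aE.
  by case: eqP j3 => [<-|_]; rewrite // mul0n addn0.
have := (le (o 0) isT, le (o 1) isT, le (o 2) isT); move=> [[l0 l1] l2].
rewrite IHk ?mul0r // (leq_trans _ hk) // ltn_neqAle.
rewrite /h !leq_add // andbT; apply: contraNneq c'c => hE.
apply/eqP/mnmP=> j; have := degh c'; have := degh c; rewrite cm c'm /h.
have : [|| j == o 0, j == o 1, j == o 2 | j == o 3] by case: j => [[|[|[|[|]]]]].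
by case/or4P=> /eqP ->; lia.
Qed.

End FourVariables.

(** * A configuration imposing independent conditions *)

Section BaseConfiguration.
Variables (K : fieldType) (charK0 : [pchar K] =i pred0).
Local Notation o k := (@Ordinal 4 k isT).

(* [sign_point k] is the image of (1, 1, 1, 1) under the [k]-th element of a group
   (Z/2)^2 of sign changes; monomials are eigenvectors of this group, and those of
   a given degree have a character determined by two parities. *)
Definition sign_exp (k l : 'I_4) : bool :=
  nth false [:: odd k (+) (1 < k)%N; odd k; (1 < k)%N] l.

Definition sign_point (k l : 'I_4) : K := (-1) ^+ sign_exp k l.

Definition sign_char (k : 'I_4) (s t : bool) : K :=
  (-1) ^+ ((odd k && s) (+) ((1 < k)%N && t)).

Definition base_config : 'M[K]_(3 + 4, 4) :=
  col_mx (\matrix_(j, l) (val j == val l)%:R) (\matrix_(k, l) sign_point k l).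

Lemma sign_point_pow k (a : 'X_{1..4}) : mnm_pow (sign_point k) a =
  sign_char k (odd (a (o 0) + a (o 1))) (odd (a (o 0) + a (o 2))).
Proof.
rewrite /mnm_pow big_ord4 /sign_point /sign_exp /sign_char /= !oddD -!exprM.
rewrite mulr1 -!exprD -[LHS]signr_odd; congr (_ ^+ nat_of_bool _).
rewrite !oddD !oddM !oddb.
by case: (odd k); case: (1 < k)%N; case: (odd (a _)); case: (odd (a _));
  case: (odd (a _)).
Qed.

(** Orthogonality of the characters of (Z/2)^2; each combination below isolates 4 f_k. *)
Lemma sign_char_sum (f : 'I_4 -> K) :
    (forall s t, \sum_k sign_char k s t * f k = 0) -> forall k, f k = 0.
Proof.
move=> f0.
pose L s t := f (o 0) + (-1) ^+ nat_of_bool s * f (o 1)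
  + (-1) ^+ nat_of_bool t * f (o 2) + (-1) ^+ nat_of_bool (s (+) t) * f (o 3).
have L0 s t : L s t = 0.
  rewrite -[RHS](f0 s t) big_ord4 addr0 !addrA /sign_char /= expr0 mul1r.
  by rewrite addbF.
have f4 (x : K) : 4%:R * x = 0 -> x = 0.
  by move/eqP; rewrite mulf_eq0 (negPf (natr_pchar0_neq0 charK0 _)) // => /eqP.
move=> k; have : [|| k == o 0, k == o 1, k == o 2 | k == o 3].
  by case: k => [[|[|[|[|]]]]].
case/or4P=> /eqP ->; apply: f4.
- transitivity (L false false + L false true + L true false + L true true).
    by rewrite /L /=; ring.
  by rewrite !L0 !addr0.
- transitivity (L false false + L false true - L true false - L true true).
    by rewrite /L /=; ring.
  by rewrite !L0 !addr0 !subr0.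
- transitivity (L false false - L false true + L true false - L true true).
    by rewrite /L /=; ring.
  by rewrite !L0 !subr0 !addr0.
- transitivity (L false false - L false true - L true false + L true true).
    by rewrite /L /=; ring.
  by rewrite !L0 !subr0 !addr0.
Qed.

(** Since m < e, monomials with first three exponents at most m receive nothing from the coordinate
    points. There the characters separate the four sign points, and each parity class is settled by
    [class_independent]. *)
Lemma base_config_independent m i (u : 'I_(3 + 4) * 'X_{1..4} -> K) :
    (0 < m)%N -> (m.*2 <= i)%N ->
    \sum_(x <- ideal_rels 4 (fun=> i.+1 - m)%N i)
      u x *: (linear_form base_config x.1 ^+ (i.+1 - m) * 'X_[x.2]) = 0 ->
  forall j c, mdeg c = m.-1 -> u (j, c) = 0.
Proof.
move=> m0 mi; set e := (i.+1 - m)%N => u0.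
have me : (m.-1 + e)%N = i by rewrite /e; lia.
have {}u0 a : \sum_(j < 3 + 4) \sum_(c <- mons 4 m.-1)
    u (j, c) * (linear_form base_config j ^+ e * 'X_[c])@_a = 0.
  rewrite -[RHS](mcoeff0 K a) -u0 raddf_sum /= big_allpairs_dep /= big_enum /=.
  have -> : (e <= i)%N by rewrite /e; lia.
  have -> : (i - e)%N = m.-1 by lia.
  by apply: eq_bigr => j _; apply: eq_bigr => c _; rewrite mcoeffZ.
have rowl k l : base_config (rshift 3 k) l = sign_point k l.
  by rewrite col_mxEd mxE.
have rowlE k : base_config (rshift 3 k) = sign_point k by apply/funext=> l.
have point0 k l : sign_point k l != 0 by rewrite signr_eq0.
have linl j : linear_form base_config (lshift 4 j) = 'X_(widen_ord (leqnSn 3) j).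
  rewrite /linear_form (bigD1 (widen_ord (leqnSn 3) j)) //= col_mxEu mxE eqxx.
  rewrite scale1r big1 ?addr0 // => l lj; rewrite col_mxEu mxE.
  case: eqP => [jl|]; last by rewrite scale0r.
  by case/eqP: lj; apply/val_inj.
have ml (j : 'I_3) c a : (linear_form base_config (lshift 4 j) ^+ e * 'X_[c])@_a =
    ((U_(widen_ord (leqnSn 3) j) *+ e + c)%MM == a)%:R.
  by rewrite linl mpolyXn -mpolyXD mcoeffX.
have ur k c : mdeg c = m.-1 -> u (rshift 3 k, c) = 0.
  (* Absorbs the nonzero factor of [mcoeff_linear_form_expX]. *)
  pose u' k c := u (rshift 3 k, c) * (e`!%:R * (mnm_fact c)%:R / mnm_pow
    (sign_point k) c).
  move=> cm; suff /eqP : u' k c = 0.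
    rewrite /u' !mulf_eq0 invr_eq0 (negPf (mnm_fact_neq0 charK0 c)).
    rewrite (negPf (mnm_pow_neq0 c (point0 k))).
    by rewrite (negPf (natr_pchar0_neq0 charK0 (fact_gt0 e))) !orbF => /eqP.
  apply: (sign_char_sum (f := fun k => u' k c)) => s t.
  apply: (class_independent charK0 (s := s) (t := t)
    (u := fun c => \sum_k sign_char k s t * u' k c) m0 mi) cm => a ai am sE tE.
  have := u0 a; rewrite big_split_ord /= big1 ?add0r => [|j _]; last first.
    rewrite big1 // => d _; rewrite ml; case: eqP => [aE|]; last by rewrite mulr0.
    have := am (widen_ord (leqnSn 3) j) (ltn_ord j).
    by rewrite -aE mnmDE mulmnE mnm1E eqxx mul1n; rewrite /e; lia.
  move=> H /=; rewrite -[RHS](mulr0 (mnm_fact a)%:R) -[X in _ = _ * X]H mulr_sumr.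
  under [LHS]eq_bigr do rewrite mulr_suml.
  rewrite exchange_big; apply: eq_bigr => l _; rewrite mulr_sumr /=.
  rewrite big_seq [RHS]big_seq; apply: eq_bigr => d; rewrite mem_mons => /eqP dm.
  rewrite mcoeff_linear_form_expX ?ai ?dm ?me //; last by move=> l'; rewrite rowl.
  rewrite rowlE [mnm_pow _ a]sign_point_pow sE tE /u'.
  by field; rewrite mnm_fact_neq0 // mnm_pow_neq0.
move=> j c cm; rewrite -(splitK j); case: (split j) => {j} [j|k] /=; last exact: ur.
(* With the sign points gone, x_j^e x^c arises only from the pair (j, c): as |c| < e, no other
   variable among the first three reaches exponent e. *)
pose jj := widen_ord (leqnSn 3) j; have := u0 (U_(jj) *+ e + c)%MM.
rewrite big_split_ord /= [X in _ + X]big1 ?addr0 => [|k _]; last first.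
  by rewrite big_seq big1 // => d; rewrite mem_mons => /eqP dm; rewrite ur ?mul0r.
rewrite (bigD1 j) //= [X in _ + X]big1 ?addr0 => [|j' j'j]; last first.
  rewrite big1 // => d _; rewrite ml; case: eqP => [/mnmP|]; last by rewrite mulr0.
  move=> /(_ (widen_ord (leqnSn 3) j')); rewrite !mnmDE !mulmnE !mnm1E eqxx.
  have -> : (jj == widen_ord (leqnSn 3) j') = false.
    by apply/negbTE; apply: contraNneq j'j => /(congr1 val) /= jE; apply/eqP/val_inj.
  have : (c (widen_ord (leqnSn 3) j') <= m.-1)%N.
    by rewrite -cm mdegE (bigD1 (widen_ord (leqnSn 3) j')) //= leq_addr.
  by rewrite /e; lia.
rewrite (bigD1_seq c) ?mons_uniq ?mem_mons ?cm //= ml eqxx mulr1 big1 ?addr0 //.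
move=> d dc; rewrite ml; case: eqP => [/addmI dE|]; last by rewrite mulr0.
by rewrite dE eqxx in dc.
Qed.

End BaseConfiguration.

(** A maximal minor that is nonzero at [L0] is a polynomial function of L. *)
Lemma generic_row_free (K : fieldType) r n p q (M : 'M[K]_(r, n) -> 'M[K]_(p,
  q)) L0 :
    (forall i j, polyfun (fun L => M L i j)) -> row_free (M L0) ->
  generic (fun L => row_free (M L)).
Proof.
move=> Mpoly free0.
have full0 : row_full (M L0)^T by rewrite /row_full mxrank_tr.
pose f := fullrankfun full0.
exists (fun L => \det (rowsub f (M L)^T)); split.
- apply: polyfun_det => i j; apply: polyfun_ext (Mpoly j (f i)) => L.
  by rewrite !mxE.
- by exists L0; rewrite -unitfE -unitmxE; apply: fullrowsub_unit.
move=> L; rewrite -unitfE -unitmxE => /mxrank_unit rk.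
rewrite /row_free eqn_leq rank_leq_row -{1}rk -[X in (_ <= X)%N]mxrank_tr.
by rewrite mxrankS // rowsub_sub.
Qed.

Lemma polyfun_mcoeff_linear_form_exp (K : fieldType) (charK0 : [pchar K] =i pred0)
    r n (j : 'I_r) e (c a : 'X_{1..n}) :
  polyfun (fun L : 'M[K]_(r, n) => (linear_form L j ^+ e * 'X_[c])@_a).
Proof.
have cst0 : polyfun (fun _ : 'M[K]_(r, n) => 0) by apply: polyfun_cst.
have [ca|ca] := boolP (c <= a)%MM; last first.
  by apply: polyfun_ext cst0 => L; rewrite mcoeff_mulX (negPf ca).
have [ae|ae] := eqVneq (mdeg (a - c)) e; last first.
  apply: polyfun_ext cst0 => L; rewrite mcoeff_mulX ca.
  by rewrite (dhomog_nemf_coeff (linear_form_exp_homog L j e)).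
apply: (@polyfun_ext _ _ _ (fun L : 'M[K]_(r, n) =>
    e`!%:R / (mnm_fact (a - c))%:R * \prod_k L j k ^+ (a - c)%MM k)).
  move=> L; rewrite mcoeff_mulX ca.
  have E := mcoeff_linear_form_exp L j ae.
  apply: (mulIf (mnm_fact_neq0 charK0 (a - c))); rewrite E mulrAC divfK //.
  exact: mnm_fact_neq0.
apply: polyfunM; first exact: polyfun_cst.
by apply: polyfun_prod => k _; apply/polyfunX/polyfun_entry.
Qed.

Section GenericBase.
Variables (K : fieldType) (charK0 : [pchar K] =i pred0).

Lemma rank_coef_mx_free n i (P : seq {mpoly K[n]}) k (E : size P = k) :
  row_free (\matrix_(x < k, t < size (mons n i)) (P`_x)@_(nth 0%MM (mons n i) t)) ->
  \rank (coef_mx i P) = k.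
Proof. by case: k / E => /eqP. Qed.

(** Here m = i + 1 - e is the multiplicity; each point imposes binom(m + 2, 3) conditions,
    independent at [base_config] and hence generically. *)
Lemma generic_dim_independent m i : (0 < m)%N -> (m.*2 <= i)%N ->
  generic (fun L : 'M[K]_(3 + 4, 4) =>
    has_dim (inv_sys L (Posz i) (fun=> Posz (i.+1 - m)))
            ('C(i + 3, 3) - 7 * 'C(m + 2, 3))).
Proof.
move=> m0 mi; set e := (i.+1 - m)%N.
pose rels := ideal_rels 4 (fun _ : 'I_(3 + 4) => e) i.
pose x0 : 'I_(3 + 4) * 'X_{1..4} := (ord0, 0%MM).
pose f (L : 'M[K]_(3 + 4, 4)) (y : 'I_(3 + 4) * 'X_{1..4}) :=
  linear_form L y.1 ^+ e * 'X_[y.2].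
pose M (L : 'M[K]_(3 + 4, 4)) : 'M[K]_(size rels, size (mons 4 i)) :=
  \matrix_(x, t) (f L (nth x0 rels x))@_(nth 0%MM (mons 4 i) t).
have ei : (e <= i)%N by rewrite /e; lia.
have ie : (i - e)%N = m.-1 by rewrite /e; lia.
have sz_rels : size rels = (7 * 'C(m + 2, 3))%N.
  rewrite -sum1_size big_allpairs_dep big_enum /=.
  under eq_bigr do rewrite ei sum1_size ie size_mons.
  rewrite sum_nat_const card_ord -bin_sub ?leq_addr //.
  by congr (_ * 'C(_, _))%N; lia.
have rels_uniq : uniq rels.
  apply: allpairs_uniq_dep => [|j _|]; first exact: enum_uniq.
    by rewrite ei mons_uniq.
  by move=> [j1 c1] [j2 c2] _ _ [-> ->].
suff gen : generic (fun L => row_free (M L)).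
  apply: generic_sub gen => L freeL.
  have := has_dim_inv_sys L i (fun=> Posz e).
  congr (has_dim _ (_ - _)%N).
    by rewrite size_mons -bin_sub ?leq_addr // addKn.
  set P := ideal_gens _ _ _; have Psz : size P = size rels by rewrite size_map.
  rewrite -sz_rels; apply: (rank_coef_mx_free (k := size rels) Psz).
  move: freeL; congr (is_true (row_free _)); apply/matrixP=> x t; rewrite !mxE.
  by rewrite (nth_map x0).
apply: (@generic_row_free _ _ _ _ _ M (base_config K)) => [x t|].
  apply: polyfun_ext (polyfun_mcoeff_linear_form_exp charK0 (nth x0 rels x).1 e
    (nth x0 rels x).2 (nth 0%MM (mons 4 i) t)) => L.
  by rewrite mxE.
rewrite -kermx_eq0; apply/eqP/row_matrixP=> k; rewrite row0.
set u := row k _; have uM : u *m M (base_config K) = 0 by rewrite -row_mul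
  mulmx_ker row0.
(* The row vector read as a function of pairs; the default 0 is never met on [rels]. *)
pose v y := if insub (index y rels) is Some x then u 0 x else 0.
have vE (x : 'I_(size rels)) : v (nth x0 rels x) = u 0 x.
  by rewrite /v index_uniq // valK.
apply/rowP=> x; rewrite [RHS]mxE -vE.
have := mem_nth x0 (ltn_ord x); rewrite mem_ideal_rels => /eqP.
case: (nth x0 rels x) => j c /= cE.
apply: (base_config_independent charK0 (i := i) m0 mi);
  last by rewrite -ie -cE addnK.
rewrite (big_nth x0) big_mkord.
under eq_bigr => y _ do rewrite vE.
apply/mpolyP=> a; rewrite mcoeff0 raddf_sum /=.
have [ai|ai] := eqVneq (mdeg a) i; last first.
  rewrite big1 // => y _; rewrite mcoeffZ.
  have := mem_nth x0 (ltn_ord y); rewrite mem_ideal_rels => /eqP yi.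
  rewrite (@dhomog_nemf_coeff _ _ mdeg (e + mdeg (nth x0 rels y).2)) ?mulr0 //.
    by apply: dhomogM; [apply: linear_form_exp_homog|rewrite dhomogX].
  by rewrite addnC yi.
have ia : (index a (mons 4 i) < size (mons 4 i))%N by rewrite index_mem mem_mons ai.
have := congr1 (fun w : 'rV_(size (mons 4 i)) => w 0 (Ordinal ia)) uM.
rewrite [LHS]mxE [RHS]mxE => uMa; rewrite -[RHS]uMa; apply: eq_bigr => y _.
by rewrite mcoeffZ [M _ _ _]mxE nth_index // mem_mons ai.
Qed.

End GenericBase.

(** * The series with numerator (1 - t^e)^7 *)

Section Series.

Lemma series_div_coef_uniq (R : comUnitRingType) (N D : {poly R}) (s : nat -> R) M :
    D`_0 \is a GRing.unit ->
    (forall k, (k < M)%N -> \sum_(j < k.+1) s j * D`_(k - j) = N`_k) ->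
  forall k, (k < M)%N -> series_div_coef N D k = s k.
Proof.
move=> D0 sN k; have [m] := ubnP k; elim: m k => // m IHm k; rewrite ltnS => km kM.
have := sN k kM; rewrite -(series_divK N k D0) !big_ord_recr /= subnn.
rewrite (eq_bigr (fun j : 'I_k => series_div_coef N D j * D`_(k - j))) => [|j _].
  by move/addrI/(mulIr D0).
by rewrite (IHm j (leq_trans (ltn_ord j) km) (ltn_trans (ltn_ord j) kM)).
Qed.

(** The coefficient of t^k in (1 - 7 t^e) / (1 - t)^(r + 1); letting r vary allows one factor 1 - t
    to be removed at a time. *)
Definition fat_point_dim e r k : int :=
  'C(k + r, r)%:Z - (if e <= k then 7 * 'C(k - e + r, r) else 0)%N%:Z.

Lemma fat_point_dim_diff e r k : (0 < e)%N ->
  fat_point_dim e r.+1 k - (if k is j.+1 then fat_point_dim e r.+1 j else 0) =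
  fat_point_dim e r k.
Proof.
move=> e0; rewrite /fat_point_dim; case: k => [|k].
  by rewrite leqNgt e0 !add0n !binn.
have E k' : 'C(k'.+1 + r.+1, r.+1) = ('C(k' + r.+1, r.+1) + 'C(k'.+1 + r, r))%N.
  by rewrite addSn binS addnS addSn.
have [ek|ke] := leqP e k.
  rewrite (leqW ek) (subSn ek) !E; lia.
have [ek|ek] := leqP e k.+1; last by rewrite E; lia.
have -> : (k.+1 - e = 0)%N by lia.
by rewrite E !add0n !binn; lia.
Qed.

Lemma fat_points_series e k : (0 < e)%N -> (k < 2 * e)%N ->
  series_div_coef ((1 - 'X^e) ^+ 7) ((1 - 'X) ^+ 4) k = fat_point_dim e 3 k.
Proof.
move=> e0; apply: series_div_coef_uniq => [|{}k ke].
  by rewrite -horner_coef0 !hornerE expr1n unitr1.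
pose S : {poly int} := \poly_(j < 2 * e) fat_point_dim e 3 j.
have -> : \sum_(j < k.+1) fat_point_dim e 3 j * ((1 - 'X) ^+ 4)`_(k - j) =
    (S * (1 - 'X) ^+ 4)`_k.
  rewrite coefM; apply: eq_bigr => j _; rewrite coef_poly.
  by rewrite (leq_trans (ltn_ord j)).
have diff (Q : {poly int}) (f : nat -> int) :
    (forall j, (j < 2 * e)%N -> Q`_j = f j) ->
  forall j, (j < 2 * e)%N -> (Q * (1 - 'X))`_j =
     f j - (if j is j'.+1 then f j' else 0).
  move=> Qf j je; rewrite mulrBr mulr1 coefB coefMX Qf //.
  by case: j je => //= j je; rewrite Qf // ltnW.
have -> : S * (1 - 'X) ^+ 4 = S * (1 - 'X) * (1 - 'X) * (1 - 'X) * (1 - 'X) by ring.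
have S3 j : (j < 2 * e)%N -> S`_j = fat_point_dim e 3 j.
  by move=> je; rewrite coef_poly je.
have S2 := diff _ _ S3; have S1 := diff _ _ (fun j je => etrans (S2 j je)
  (fat_point_dim_diff 2 j e0)).
have S0 := diff _ _ (fun j je => etrans (S1 j je) (fat_point_dim_diff 1 j e0)).
have := diff _ _ (fun j je => etrans (S0 j je) (fat_point_dim_diff 0 j e0)) k ke.
move=> ->.
(* Below degree 2e only 1 - 7 t^e survives. *)
have -> : (1 - 'X^e) ^+ 7 = 1 - 7%:R *: 'X^e + 'X^(2 * e) *
    (21%:R - 35%:R *: 'X^e + 35%:R *: 'X^e ^+ 2 - 21%:R *: 'X^e ^+ 3
      + 7%:R *: 'X^e ^+ 4 - 'X^e ^+ 5) :> {poly int}.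
  by rewrite mulnC exprM -!mul_polyC !rmorph_nat; ring.
rewrite coefD coefXnM ke addr0 coefB coef1 coefZ coefXn /fat_point_dim !bin0.
case: k ke => [|k] ke.
  have -> : (0%N == e) = false by lia.
  by rewrite leqNgt e0 /= mulr0 !subr0.
have [ek|ek|ek] := ltngtP e k.+1.
- by rewrite -ltnS ek !addn0 !bin0 muln1 mulr0 subr0 subrr.
- have -> : (e <= k)%N = false by lia.
  by rewrite !addn0 !bin0 mulr0 !subr0 subrr.
- have -> : (e <= k)%N = false by lia.
  by rewrite !addn0 !bin0 muln1 mulr1 subr0 addrAC subrr.
Qed.

End Series.

(** * Seven points in projective 3-space *)

Section SevenPoints.
Variables (K : fieldType) (charK0 : [pchar K] =i pred0).

(* Iterating this relabelling of the points moves the first four of them through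
   the complements of the seven lines of a Fano plane. *)
Definition fano_shift_fun (j : 'I_7) : 'I_7 :=
  inord (nth 0%N [:: 6; 2; 3; 4; 5; 0; 1] j).

Lemma fano_shift_inj : injective fano_shift_fun.
Proof.
apply: (can_inj (g := fun j : 'I_7 => inord (nth 0%N [:: 5; 6; 1; 2; 3; 4; 0] j))).
by case=> [[|[|[|[|[|[|[|]]]]]]]] //= jlt; apply/val_inj; rewrite /= !inordK.
Qed.

Definition fano_shift : 'S_7 := perm fano_shift_inj.

Definition exps7 (s : seq int) (j : 'I_7) : int := nth 0 s j.

Definition generic_dim i (s : seq int) m : Prop :=
  generic (fun L : 'M[K]_(7, 4) => has_dim (inv_sys L i (exps7 s)) m).

(** A Cremona transformation at the first four points adds [c] to the degree and to the other three
    exponents; the relabelling brings the next four base points to the front. *)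
Lemma generic_dim_step i c (e0 e1 e2 e3 e4 e5 e6 : int) m :
    i + (i + c) = e0 + e1 + e2 + e3 - 4%:R ->
    generic_dim (i + c) [:: e6 + c; e2; e3; e4 + c; e5 + c; e0; e1] m ->
  generic_dim i [:: e0; e1; e2; e3; e4; e5; e6] m.
Proof.
move=> iE gen.
apply: (@generic_cremona K charK0 4 3 i (i + c) (exps7 [:: e0; e1; e2; e3; e4;
  e5; e6])
  (exps7 [:: e0; e1; e2; e3; e4 + c; e5 + c; e6 + c])).
- by rewrite iE big_ord4 /exps7 /=; ring.
- by case=> [[|[|[|[|]]]]].
- by case=> [[|[|[|]]]] //= k; rewrite /exps7 /=; ring.
apply: (generic_row_perm charK0 (s := fano_shift)).
apply: generic_sub gen => L; apply: has_dim_ext => F.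
suff -> : exps7 [:: e0; e1; e2; e3; e4 + c; e5 + c; e6 + c] \o fano_shift =
  exps7 [:: e6 + c; e2; e3; e4 + c; e5 + c; e0; e1] by [].
apply/funext=> -[[|[|[|[|[|[|[|]]]]]]] //= jlt];
  by rewrite /exps7 /= permE /fano_shift_fun /= inordK.
Qed.

(** Complements of two Fano lines share two points, so each step adds 2c to the exponent sum of any
    later base and c to the degree: the shift stays [c] throughout. Each point lies on three lines,
    hence gains 3c. *)
Lemma generic_dim_uniform i a c m : c = 4%:R * a - 4%:R - 2%:R * i ->
    generic_dim (i + 7%:R * c) (nseq 7 (a + 3%:R * c)) m ->
  generic_dim i (nseq 7 a) m.
Proof.
move=> cE gen.
do 7 (apply: (generic_dim_step (c := c)); first by rewrite cE; ring).
move: gen; congr (generic_dim _ _ _); first by ring.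
by rewrite /=; congr [:: _; _; _; _; _; _; _]; ring.
Qed.

Lemma generic_dim_top i e : (0 < e)%N -> (i < e)%N ->
  generic_dim (Posz i) (nseq 7 (Posz e)) 'C(i + 3, 3).
Proof.
move=> e0 ie; apply: genericT => L.
have E j : exps7 (nseq 7 (Posz e)) j = Posz e by rewrite /exps7 nth_nseq ltn_ord.
have := has_dim_inv_sys L i (exps7 (nseq 7 (Posz e))).
congr (has_dim _ _).
set P := ideal_gens _ _ _; have -> : \rank (coef_mx i P) = 0%N.
  have P0 : P = [::].
    case PE: P => [//|f P'].
    have /ideal_gensP[j [a []]] : f \in P by rewrite PE mem_head.
    by rewrite /= E /=; lia.
  by apply/eqP; rewrite -leqn0 (leq_trans (rank_leq_row _)) // P0.
by rewrite subn0 size_mons -bin_sub ?leq_addr // addKn.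
Qed.

(** For [D] equal to d0 and [i] to d1, [e] is the exponent reached after the seven transformations.
    Positivity will make d0 the top degree. *)
Lemma generic_dim_base i e D : (28 * e = 28 + D + 13 * i)%N -> (i < 13)%N ->
  exists m, [/\ (0 < m)%N, Posz m = fat_point_dim e 3 i &
                generic_dim (Posz i) (nseq 7 (Posz e)) m].
Proof.
move=> eE i13; have e0 : (0 < e)%N by lia.
rewrite /fat_point_dim; have [ei|ie] := leqP e i; last first.
  exists 'C(i + 3, 3); split; [by rewrite bin_gt0 leq_addl|by rewrite subr0|].
  exact: generic_dim_top.
have [m mE] : exists m, (i.+1 = e + m)%N by exists (i.+1 - e)%N; lia.
have m0 : (0 < m)%N by lia.
(* The relation [eE] gives 28 m <= 15 i, and i < 13 turns this into 2 m < i + 1. *)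
have mi : (m.*2 <= i)%N by lia.
have pos : (7 * 'C(m + 2, 3) < 'C(i + 3, 3))%N.
  apply: (@leq_trans 'C(m.*2 + 3, 3)); last by rewrite leq_bin2l // leq_add2r.
  have m6 : (m <= 6)%N by lia.
  by move: m0 m6; clear; case: m => [|[|[|[|[|[|[|]]]]]]].
exists ('C(i + 3, 3) - 7 * 'C(m + 2, 3))%N; split; first by rewrite subn_gt0.
  have -> : (i - e + 3 = m + 2)%N by lia.
  by rewrite subzn // ltnW.
apply: generic_sub (generic_dim_independent charK0 m0 mi) => L.
apply: has_dim_ext => F; rewrite (_ : (fun=> _) = exps7 (nseq 7 (Posz e))) //.
by apply/funext=> j; rewrite /exps7 nth_nseq ltn_ord mE addnK.
Qed.

End SevenPoints.

(** * The top degree of the Hilbert series *)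

Lemma has_dim_graded_piece_eq0 (K : fieldType) n r (g : 'I_r -> {mpoly K[n]}) i k :
  (i <= k)%N -> has_dim (graded_piece g i) 0 -> has_dim (graded_piece g k) 0.
Proof.
move=> ik [v [_ _ gen]].
(* The grading is standard: a monomial of higher degree is a variable times one of degree one less,
   so the vanishing propagates upwards. *)
have monI j (a : 'X_{1..n}) : mdeg a = (j + i)%N -> 'X_[a] \in in_ideal g.
  elim: j a => [|j IHj] a ai.
    have [|c] := gen (quot_pi g 'X_[a]).
      by exists 'X_[a] => //; rewrite dhomogX /= ai.
    rewrite big_ord0 -(quot_pi0 g) => /eqP.
    by rewrite quot_piE subr0.
  have [l al] : exists l, (0 < a l)%N.
    apply/existsP; apply: contraT; rewrite negb_exists => /forallP a0.
    move: ai; rewrite mdegE big1 // => l _.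
    by have := a0 l; rewrite -eqn0Ngt => /eqP.
  have -> : a = (U_(l) + (a - U_(l)))%MM.
    by rewrite addmC submK // lep1mP -lt0n.
  rewrite mpolyXD; apply: in_idealM; apply: IHj.
  have : mdeg (U_(l) + (a - U_(l))) = mdeg a by rewrite addmC submK // lep1mP -lt0n.
  by rewrite mdegD mdeg1 ai; lia.
apply: has_dim_ext (has_dim0 _) => w; split=> [->|[f fk ->]].
  by exists 0; rewrite ?rpred0 ?quot_pi0.
rewrite -(quot_pi0 g); apply/eqP; rewrite quot_piE subr0 [f]mpolyE big_seq.
apply: (big_ind (fun p => p \in in_ideal g)) => [|p q|a af].
- by have [] := in_ideal_zmod_closed g.
- move=> pI qI; have [I0 IB] := in_ideal_zmod_closed g.
  by have := IB p (0 - q) pI (IB 0 q I0 qI); rewrite sub0r opprK.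
rewrite -mul_mpolyC; apply: in_idealM; apply: (monI (k - i)%N).
by rewrite subnK // (dhomogP _ _ _ fk _ af).
Qed.

Theorem proposition8p5 (K : fieldType) (charK0 : [pchar K] =i pred0)
    (d d0 d1 : nat) (d_ge1 : (1 <= d)%N)
    (d0d1 : (28 * (d - 1) = 13 * d0 + d1)%N) (d1_lt13 : (d1 < 13)%N) :
  (* 6 * d0 <= 13 * (d - 1), so the natural-number subtraction is exact *)
  let c : int :=
    series_div_coef ((1 - 'X^(1 + 13 * (d - 1) - 6 * d0)) ^+ 7)
                    ((1 - 'X) ^+ 4) d1 in
  (exists U : 'M[K]_(7, 4) -> Prop,
     [/\ zariski_open U,
         exists L, U L
       & forall L, U L ->
         exists H : {poly nat},
           [/\ is_hilbert_series (fun j => linear_form L j ^+ d) H,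
               size H = d0.+1
             & (lead_coef H)%:Z = c]])
  /\ ((73 <= d)%N \/ (15 * d1 <= d0)%N -> c = 'C(d1 + 3, 3)%:Z).
Proof.
set e := (1 + 13 * (d - 1) - 6 * d0)%N.
(* Indeed 28 e = 28 + 13 (13 d0 + d1) - 168 d0. *)
have eE : (28 * e = 28 + d0 + 13 * d1)%N by rewrite /e; lia.
have e_gt0 : (0 < e)%N by lia.
have d1_lt2e : (d1 < 2 * e)%N by lia.
rewrite /= (fat_points_series e_gt0 d1_lt2e); split; last first.
  (* By [eE], d1 < e means 15 d1 < 28 + d0; and d >= 73 forces d0 >= 155, while 15 d1 <= 180. *)
  move=> large; rewrite /fat_point_dim leqNgt (_ : (d1 < e)%N) ?subr0 //.
  by case: large; lia.
have [m [m_gt0 mE gen_base]] := generic_dim_base charK0 eE d1_lt13.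
have gen_top : generic_dim K (Posz d0) (nseq 7 (Posz d)) m.
  apply: (generic_dim_uniform charK0 erefl).
  by move: gen_base; congr (generic_dim _ _ (nseq 7 _) _); lia.
have gen_zero : generic_dim K (Posz d0.+1) (nseq 7 (Posz d)) 0.
  apply: (generic_dim_uniform charK0 erefl).
  (* In degree d0 + 1 the seven transformations lead to degree d1 - 13 < 0. *)
  have -> : Posz d0.+1 + 7%:R * (4%:R * Posz d - 4%:R - 2%:R * Posz d0.+1) =
      Negz (12 - d1) by lia.
  by apply: genericT => L; apply/has_dim_inv_sys_neg.
have [U [Uopen Unonempty UP]] := generic_zariski (generic_and charK0 gen_top
  gen_zero).
exists U; split=> // L /UP[dim_top dim_zero].
have expsE : exps7 (nseq 7 (Posz d)) = fun=> Posz d.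
  by apply/funext=> j; rewrite /exps7 nth_nseq ltn_ord.
rewrite expsE in dim_top dim_zero.
pose g j := linear_form L j ^+ d.
have gtop : has_dim (graded_piece g d0) m by apply: has_dim_graded_inv_sys dim_top.
have gzero : has_dim (graded_piece g d0.+1) 0.
  exact: has_dim_graded_inv_sys dim_zero.
(* The dimensions in degrees below d0 are only known to exist; they are chosen after [L]. *)
have dim_ex k : exists dim_k, has_dim (graded_piece g k) dim_k.
  by eexists; apply: has_dim_graded_inv_sys (has_dim_inv_sys L k (fun=> Posz d)).
have [h hP] := choice dim_ex.
have htop : h d0 = m := has_dim_uniq (hP d0) gtop.
have h0 : h d0 != 0 by rewrite htop -lt0n.
exists (\poly_(k < d0.+1) h k); split.
- move=> k; rewrite coef_poly; case: ltnP => // kd.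
  exact: has_dim_graded_piece_eq0 kd gzero.
- exact: size_poly_eq.
- by rewrite lead_coef_poly // htop.
Qed.
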